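(* Let $(\Gamma,h)$ be a tropical curve satisfying Assumption A and let $\varphi_0\colon C_0\to X_0$ be a pre-log curve of type $(\Gamma,h)$ in the central fiber of a toric degeneration defined respecting $(\Gamma,h)$. Let $L$ be the loop part (of $\Gamma^c$, i.e. the image of the loop part of $\Gamma$), cut $L$ at each 3- or higher valent vertex to obtain chains of segments $\{l_m\}$, and let $U_m\subset N_{\mathbb C}$ be spanned by the direction vectors of the segments of $l_m$. Then elements of $H=H^0(C_0,\mathcal N_{\varphi_0}^\vee\otimes\omega_{C_0})$ are described by the following data (attaching to an element its residues at the flags of $\Gamma^c$ identifies $H$ with the space of such data): (I) Give the value zero to all the flags not contained in $L$. (II) Give a value in $(U_m)^\perp\subset(N_{\mathbb C})^\vee$ to each of the flags associated to the edges of $l_m$. (III) The data in (I) and (II) give an element of $H$ if and only if the following conditions are satisfied. (a) At each 3-valent vertex $p$, $u_1+u_2+u_3=0$ in $(N_{\mathbb C})^\vee$, where $u_1,u_2,u_3$ are the data attached to the three flags with vertex $p$. (b) At each $(r+2)$-valent vertex $q$ ($r\ge2$), let $E_1,\dots,E_{r+2}$ be the edges emanating from $q$, with primitive integral directions $n_i\in N$ pointing away from $q$ and weights $w_i$, let $\alpha_j\in N_{\mathbb C}^\vee$ be the value attached to the flag $(q,E_j)$, and let $\zeta$ be an affine coordinate on the component $C_{0,q}\cong\mathbb P^1$ such that the point corresponding to $E_{r+2}$ is $\infty$ and that corresponding to $E_i$ is $p_i\in\mathbb C$ $(1\le i\le r+1)$. Put $a_{i,j}=w_i\langle\alpha_j,n_i\rangle$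 for $1\le i,j\le r+1$. Then $\alpha_{r+2}=-\sum_{j=1}^{r+1}\alpha_j$, $a_{i,i}=0$ for $i=1,\dots,r+1$, and all coefficients $A_k(a_{i,j})$, $k=0,\dots,r-1$, of the polynomial $$P(\zeta)=\sum_{\substack{i,j=1\\ i\ne j}}^{r+1}a_{i,j}\prod_{l\in\{1,\dots,r+1\}\setminus\{i,j\}}(\zeta-p_l)=\sum_{k=0}^{r-1}A_k(a_{i,j})\zeta^k$$ vanish. (c) The data in (II) are compatible: the sum of the values attached to the two flags of any edge of $l_m$ is zero.
   Context: **Tropical curves.** $N$ is a free abelian group of rank $n$, $N_K=N\otimes_{\mathbb Z}K$, $U^\perp\subset N_{\mathbb C}^\vee$ the annihilator of $U$. $\Gamma$ is the complement of the set of 1-valent vertices in a connected finite graph with positive integer edge weights $w(E)$; its non-compact edges are unbounded. A tropical curve is a proper continuous map $h\colon\Gamma\to N_{\mathbb R}$ such that each edge is either contracted to a point or mapped homeomorphically onto a subset of an affine line of rational slope; vertices map into $N_{\mathbb Q}$; and for each image $p$ of a vertex and each connected component $\Gamma_1$ of $h^{-1}(p)$, $\sum_jw(E_j)u_j=0$, the sum over edges outside $\Gamma_1$ emanating from $\Gamma_1$, $u_j\in N$ the primitive integral direction of $h(E_j)$ pointing away from $p$. 3-valent: all vertices of $\Gamma$ have valence at most 3; immersive: $h$ embeds every edge. **Assumption A.** (i) $\Gamma$ is 3-valent; (ii) $h$ may contract bounded edges but does not contract a loop to a point; (iii) $(\Gamma,h)$ can be deformed into an immersive tropical curve, i.e.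 it is a limit of immersive 3-valent tropical curves with domain $\Gamma$ of a fixed combinatorial type (some edge lengths possibly tending to $0$); (iv) the inverse image of any vertex of $h(\Gamma)$ is a disjoint union of closed subgraphs of $\Gamma$ (hence trees and vertices). $\Gamma^c$ is obtained from $\Gamma$ by contracting all edges contracted by $h$. Vertices and valences are those of $\Gamma^c$ (when several vertices of $\Gamma^c$ have the same image in $h(\Gamma)$ they are treated separately); 2-valent vertices are neglected (at such a vertex the two flag values sum to zero). Flags are pairs (vertex, adjacent edge). The loop part is the union of edges whose removal lowers the first Betti number. **Degenerations.** Let $X$ be a toric variety whose fan contains all rays spanned by directions of unbounded edges. Choose a rational polyhedral decomposition $\mathscr P$ of $N_{\mathbb R}$ with $h(\Gamma)$ in its 1-skeleton and asymptotic fan defining $X$. After rescaling so that everything is integral and the integral length of each bounded edge is a multiple of its weight, and adding 2-valent vertices so that the vertices of $\mathscr P$ on $h(\Gamma)$ are exactly the images of vertices, the (closures of the) cones over cells of $\mathscr P\times\{1\}$ form a fan in $(N\oplus\mathbb Z)\otimes\mathbb R$ defining a toric degeneration $\mathfrak X\to\mathbb C$ ''defined respecting $(\Gamma,h)$'', with central fiber $X_0=\bigcup_vX_{0,v}$, $v$ over vertices of $\mathscr P$, $X_{0,v}$ the toric variety of the fan of $\mathscr P$ at $v$. **Pre-log curves.** A curve in a toric variety is torically transverse if it is disjoint from toric strata of codimension greater than one; a stable map to a toric variety is torically transverse if its image is and the preimage of the big torus is dense. A pre-log curve is a stable map $\varphi_0\colon C_0\to X_0$ such that each $C_0\times_{X_0}X_{0,v}\to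 X_{0,v}$ is torically transverse and every point mapped to the singular locus of $X_0$ is a node whose branches map to different components of $X_0$ with equal intersection multiplicities with the corresponding toric divisors. It is of type $(\Gamma,h)$ if its components $C_{0,V}$ correspond bijectively to vertices $V$ of $\Gamma^c$, and for $V$ mapped to $v$, $C_{0,V}\cong\mathbb P^1$ maps to $X_{0,v}$ by a non-constant torically transverse map meeting the toric divisors exactly in one point for each edge $E$ of $\Gamma^c$ at $V$ (distinct points for distinct edges), on the divisor corresponding to the direction of $E$, with multiplicity $w(E)$; nodes correspond to bounded edges of $\Gamma^c$. **Sheaves.** $\mathcal N_{\varphi_0}=\varphi_0^*\Theta_{\mathfrak X/\mathbb C}/\Theta_{C_0/O_0}$ is the log normal sheaf ($\mathfrak X$ with toric log structure, $C_0$ with the compatible log structure, log smooth over the standard log point $O_0$). Concretely $\varphi_0^*\Theta_{\mathfrak X/\mathbb C}\cong N\otimes\mathcal O_{C_0}$; $\Theta_{C_0/O_0}$ is dual to $\omega_{C_0}(\sum x_k)$, with $x_k$ the points corresponding to unbounded edges and $\omega_{C_0}$ the dualizing sheaf (1-forms with at most logarithmic poles at nodes, opposite residues on the two branches); the inclusion $\Theta_{C_0/O_0}\to N\otimes\mathcal O_{C_0}$ is dual to $m\mapsto d\log\varphi_0^*\chi^m$, $m\in N^\vee$, on each component. Thus $H\subset H^0(C_0,N_{\mathbb C}^\vee\otimes\omega_{C_0})$, and the value of an element at a flag $(V,E)$ is its $N_{\mathbb C}^\vee$-valued residue on $C_{0,V}$ at the point corresponding to $E$ (zero for unbounded $E$).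 *)

(* Defs.v *)
(* N is Z^n, written as integer columns 'cV[int]_n, and its dual
   as integer rows; R is any realType and the complex numbers are R[i]. *)
From HB Require Import structures.
From mathcomp Require Import all_boot all_order all_algebra.
From mathcomp Require Import generic_quotient fraction.
From mathcomp Require Import boolp classical_sets cardinality reals.
From mathcomp Require Import complex.

Set Implicit Arguments.
Unset Strict Implicit.
Unset Printing Implicit Defensive.

Import Order.TTheory GRing.Theory Num.Theory.
Local Open Scope ring_scope.

(* An edge e has two ends e.false and e.true; an end carrying None is the
   non-compact end left by the removal of a 1-valent vertex. *)
Record wgraph := WGraph {
  vertex : finType;
  edge : finType;
  weight : edge -> nat;
  endpt : edge -> bool -> option vertex }.

Section Graphs.
Variable G : wgraph.

(* The side is recorded so that a self-loop would count as two flags. *)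
Definition flag :=
  {f : vertex G * edge G * bool | endpt f.1.2 f.2 == Some f.1.1}.
Definition fv (f : flag) : vertex G := (val f).1.1.
Definition fe (f : flag) : edge G := (val f).1.2.
Definition fs (f : flag) : bool := (val f).2.

Definition opposite (f f' : flag) := (fe f == fe f') && (fs f != fs f').

Definition valence (v : vertex G) : nat := #|[set f : flag | fv f == v]|.

Definition bounded (e : edge G) : bool := endpt e false && endpt e true.

Definition incident (e : edge G) (v : vertex G) : bool :=
  [exists b, endpt e b == Some v].

Definition adjacent (S : {set edge G}) : rel (vertex G) := fun v v' =>
  [exists e in S, exists b,
     (endpt e b == Some v) && (endpt e (~~ b) == Some v')].

Definition components (S : {set edge G}) : nat :=
  n_comp (adjacent S) [set: vertex G].

(* First Betti number of the graph with all the vertices of G and the edges in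
   S, by Euler's formula; unbounded edges retract to their vertex.  The natural
   number subtraction never truncates. *)
Definition betti1 (S : {set edge G}) : nat :=
  (#|[set e in S | bounded e]| + components S - #|vertex G|)%N.

Definition loop_part : {set edge G} :=
  [set e | betti1 ([set: edge G] :\ e) < betti1 [set: edge G]]%N.

(* Consecutive edges of L that are not separated by the cutting. *)
Definition chain_step : rel (edge G) := fun e e' =>
  [&& e \in loop_part, e' \in loop_part &
      [exists v, [&& (valence v < 3)%N, incident e v & incident e' v]]].

(* The chain l_m through the edge e of L. *)
Definition chain (e : edge G) : {set edge G} :=
  [set e' | connect chain_step e e'].

(* An edge always keeps at least one vertex: only the bare line has an edge with
   none, and it acquires one when it is subdivided by a polyhedral decomposition. *)
Definition is_wgraph : Prop :=
  [/\ components [set: edge G] = 1%N,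
      forall e : edge G, (0 < weight e)%N,
      forall e : edge G, endpt e false || endpt e true
    & forall v, valence v <> 1%N].

End Graphs.

(* The map h, up to reparametrisation of the edges: positions of the vertices,
   and for every edge e the primitive integral direction [dir e b] of h(e)
   pointing away from the end b, with the convention [dir e b = 0] when e is
   contracted. *)
Record tropical (n : nat) := Tropical {
  tgraph :> wgraph;
  pos : vertex tgraph -> 'cV[rat]_n;
  dir : edge tgraph -> bool -> 'cV[int]_n }.

Definition primitive (n : nat) (u : 'cV[int]_n) : Prop :=
  forall (k : int) (u' : 'cV[int]_n), u = k *: u' -> `|k| = 1.

Section TropicalCurves.
Variable n : nat.
Implicit Type T : tropical n.

Definition contracted T (e : edge T) : bool := dir e false == 0.

Definition contracted_edges T : {set edge T} := [set e | contracted e].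

Definition contraction_class T (v : vertex T) : {set vertex T} :=
  [set w | connect (adjacent (contracted_edges T)) v w].

Definition cvertex T : finType :=
  {A : {set vertex T} | A \in codom (@contraction_class T)}.

Definition cproj T (v : vertex T) : cvertex T :=
  exist _ (contraction_class v) (codom_f (@contraction_class T) v).

Definition cedge T : finType := {e : edge T | ~~ contracted e}.

Definition contraction T : tropical n :=
  @Tropical n
    (@WGraph (cvertex T) (cedge T) (fun e => weight (val e))
       (fun e b => omap (@cproj T) (endpt (val e) b)))
    (fun V => pos (iinv (valP V)))
    (fun e b => dir (val e) b).

(* The components of h^-1(p) containing a vertex are the vertices of the
   contraction; at the other components, which are interior points of edges,
   balancing is automatic. *)
Definition balanced T : Prop :=
  forall V : vertex (contraction T),
    \sum_(f : flag (contraction T) | fv f == V)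
       dir (fe f) (fs f) *+ weight (fe f) = 0.

Definition is_tropical T : Prop :=
  [/\ is_wgraph T,
      forall (e : edge T) b, dir e (~~ b) = - dir e b,
      forall e : edge T, primitive (dir e false) \/ contracted e && bounded e,
      forall (e : edge T) b v v', endpt e b = Some v -> endpt e (~~ b) = Some v' ->
        exists2 l : rat, 0 < l & pos v' = pos v + l *: map_mx intr (dir e b)
    & balanced T].

Definition three_valent T : Prop := forall v : vertex T, (valence v <= 3)%N.

Definition immersive T : Prop := forall e : edge T, ~~ contracted e.

(* T is a limit of immersive tropical curves on the same weighted graph whose edge
   directions do not vary. *)
Definition deformable_to_immersive T : Prop :=
  exists (dir' : edge T -> bool -> 'cV[int]_n)
         (pos' : nat -> vertex T -> 'cV[rat]_n),
    [/\ forall k, let T' := @Tropical n T (pos' k) dir' in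
          [/\ is_tropical T', three_valent T' & immersive T'],
        forall (e : edge T) b, ~~ contracted e -> dir' e b = dir e b
      & forall (eps : rat), 0 < eps -> exists K, forall k, (K <= k)%N ->
          forall v i, `|pos' k v i 0 - pos v i 0| < eps].

End TropicalCurves.

Local Open Scope classical_set_scope.

Section Polyhedra.
Variables (R : realType) (n : nat).

Definition real_pairing (m : 'rV[R]_n) (x : 'cV[R]_n) : R := (m *m x) 0 0.

Definition lattice_pairing (m : 'rV[int]_n) (x : 'cV[R]_n) : R :=
  real_pairing (map_mx intr m) x.

Definition rational_polyhedron (A : set 'cV[R]_n) : Prop :=
  exists s : seq ('rV[int]_n * rat),
    A = [set x | forall mc, mc \in s -> lattice_pairing mc.1 x <= ratr mc.2].

Definition contains_line (A : set 'cV[R]_n) : Prop :=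
  exists x u, u != 0 /\ forall t : R, A (x + t *: u).

Definition is_face (F A : set 'cV[R]_n) : Prop :=
  F !=set0 /\ exists (m : 'rV[R]_n) (c : R),
    (forall x, A x -> real_pairing m x <= c) /\
    F = A `&` [set x | real_pairing m x = c].

Definition polyhedral_decomposition (P : set (set 'cV[R]_n)) : Prop :=
  [/\ finite_set P,
      forall A, P A ->
        [/\ A !=set0, rational_polyhedron A & ~ contains_line A],
      forall A F, P A -> is_face F A -> P F,
      forall A B, P A -> P B -> A `&` B !=set0 ->
        is_face (A `&` B) A /\ is_face (A `&` B) B
    & forall x, exists2 A, P A & A x].

Definition dim_le1 (A : set 'cV[R]_n) : Prop :=
  exists x u, forall y, A y -> exists t : R, y = x + t *: u.

Definition one_skeleton (P : set (set 'cV[R]_n)) : set 'cV[R]_n :=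
  [set x | exists A, [/\ P A, dim_le1 A & A x]].

Definition asymptotic_cone (A : set 'cV[R]_n) : set 'cV[R]_n :=
  [set y | forall x t, A x -> 0 <= t -> A (x + t *: y)].

Definition asymptotic_fan (P : set (set 'cV[R]_n)) : set (set 'cV[R]_n) :=
  asymptotic_cone @` P.

Definition ray (u : 'cV[R]_n) : set 'cV[R]_n :=
  [set y | exists2 t : R, 0 <= t & y = t *: u].

End Polyhedra.

Section TropicalInRealSpace.
Variables (R : realType) (n : nat) (T : tropical n).

Definition posR (v : vertex T) : 'cV[R]_n := map_mx ratr (pos v).
Definition dirR (e : edge T) (b : bool) : 'cV[R]_n := map_mx intr (dir e b).

(* h of the edge e deprived of its vertices *)
Definition edge_interior (e : edge T) : set 'cV[R]_n :=
  [set x | exists b v, endpt e b = Some v /\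
     (exists2 t : R, 0 < t & x = posR v + t *: dirR e b) /\
     forall v', endpt e (~~ b) = Some v' ->
       exists2 t : R, 0 < t & x = posR v' + t *: dirR e (~~ b)].

Definition tropical_image : set 'cV[R]_n :=
  [set x | (exists v, x = posR v) \/ exists e, edge_interior e x].

Definition assumptionA : Prop :=
  [/\ three_valent T,
      betti1 (contracted_edges T) = 0%N,
      deformable_to_immersive T
    & forall v (e : edge T), ~~ contracted e -> ~ edge_interior e (posR v)].

(* T is taken after rescaling and insertion of the 2-valent vertices.  The toric
   variety X, the general fibre, is that of the fan [asymptotic_fan P]. *)
Definition respects (P : set (set 'cV[R]_n)) : Prop :=
  [/\ polyhedral_decomposition P,
      tropical_image `<=` one_skeleton P
      /\ (forall x, P [set x] -> exists z : 'cV[int]_n, x = map_mx intr z),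
      forall (e : edge T) b, endpt e b -> ~~ endpt e (~~ b) ->
        asymptotic_fan P (ray (dirR e b)),
      forall x, tropical_image x -> (P [set x] <-> exists v, x = posR v)
    & forall (e : edge T) b v v', endpt e b = Some v -> endpt e (~~ b) = Some v' ->
        exists k : nat, pos v' = pos v + (k * weight e)%:R *: map_mx intr (dir e b)].

End TropicalInRealSpace.

Section ProjectiveLine.
Variable C : fieldType.

(* None is the point at infinity. *)
Definition P1 := option C.

Definition ratfun := {fraction {poly C}}.
Definition zeta : ratfun := FracField.tofrac 'X.
Definition ratfun_const (c : C) : ratfun := FracField.tofrac c%:P.

(* g is regular at p, with value c *)
Definition has_value (g : ratfun) (p : P1) (c : C) : Prop :=
  exists a b : {poly C}, b != 0 /\ g = FracField.tofrac a / FracField.tofrac b /\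
    match p with
    | Some z => b.[z] != 0 /\ c = a.[z] / b.[z]
    | None => (size a <= size b)%N /\ c = a`_(size b).-1 / lead_coef b
    end.

Definition local_param (p : P1) : ratfun :=
  if p is Some z then zeta - ratfun_const z else zeta^-1.

(* d zeta / d t for the local parameter t above *)
Definition dzeta_dt (p : P1) : ratfun :=
  if p is Some _ then 1 else - zeta ^+ 2.

(* A rational function g stands for the rational 1-form g d zeta. *)
Definition regular_form (g : ratfun) (p : P1) : Prop :=
  exists c, has_value (g * dzeta_dt p) p c.
Definition log_coef (g : ratfun) (p : P1) : ratfun :=
  g * dzeta_dt p * local_param p.
Definition log_form (g : ratfun) (p : P1) : Prop :=
  exists c, has_value (log_coef g p) p c.
Definition residue (g : ratfun) (p : P1) : C :=
  xget 0 [set c | has_value (log_coef g p) p c].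

(* g = a / b is sent to a' / a - b' / b, so that d log g = (dlog g) d zeta. *)
Definition dlog (g : ratfun) : ratfun :=
  let q : {ratio {poly C}} := repr g in
  FracField.tofrac (\n_q)^`() / FracField.tofrac \n_q
  - FracField.tofrac (\d_q)^`() / FracField.tofrac \d_q.

Definition zariski_open (A : set P1) : Prop := A = set0 \/ finite_set (~` A).

Definition agrees_on (A : set P1) (F : P1 -> C) (g : ratfun) : Prop :=
  forall p, A p -> has_value g p (F p).

Definition regular_on (A : set P1) (F : P1 -> C) : Prop :=
  forall p, A p -> exists B g, [/\ zariski_open B, B p & agrees_on (A `&` B) F g].

Definition vanishing_order (F : P1 -> C) (p : P1) (k : nat) : Prop :=
  exists A g, [/\ zariski_open A, A p, agrees_on A F g &
    exists2 c, c != 0 & has_value (g / local_param p ^+ k) p c].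

Definition moebius (A : 'M[C]_2) (p : P1) : P1 :=
  let: (x, y) := if p is Some z then (z, 1) else (1, 0) in
  let d := A 1 0 * x + A 1 1 * y in
  if d == 0 then None else Some ((A 0 0 * x + A 0 1 * y) / d).

End ProjectiveLine.

Section CentralFibre.
Variables (R : realType) (n : nat) (P : set (set 'cV[R]_n)).
Local Notation C := R[i].
Implicit Types (v u : 'cV[R]_n) (tau : set 'cV[R]_n) (m : 'rV[int]_n).

Definition constant_on tau m : Prop :=
  forall y z, tau y -> tau z -> lattice_pairing m y = lattice_pairing m z.

(* Orbit decomposition: the torus orbits of X_0 correspond to the cells tau of P,
   and the orbit of tau is the set of characters of the lattice of all m constant
   on tau (as the vertices of P are integral, this is the lattice orthogonal to
   the cone over tau x {1}; it is also the lattice orthogonal to the cone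
   generated by tau - v, for any vertex v of tau).  A character is extended by zero
   to N^\vee, so that its value at m is the value of the monomial m at the point,
   in any chart where this monomial is regular. *)
Definition X0_point := (set 'cV[R]_n * ('rV[int]_n -> C))%type.

Definition in_X0 (x : X0_point) : Prop :=
  [/\ P x.1, forall m, x.2 m != 0 <-> constant_on x.1 m
    & forall m m', constant_on x.1 m -> constant_on x.1 m' ->
        x.2 (m + m') = x.2 m * x.2 m'].

(* X_{0,v}, the toric variety of the fan of all the cones generated by tau - v. *)
Definition in_X0v v (x : X0_point) : Prop := in_X0 x /\ x.1 v.

Definition in_big_torus v (x : X0_point) : Prop := in_X0v v x /\ x.1 = [set v].

(* The affine chart of the cone generated by tau - v: the orbits of its faces. *)
Definition in_chart v tau (x : X0_point) : Prop := in_X0v v x /\ x.1 `<=` tau.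

(* The singular locus of X_0, up to the singularities of the components, which lie
   in strata missed by torically transverse maps. *)
Definition in_double_locus (x : X0_point) : Prop :=
  in_X0 x /\ exists v v', [/\ v != v', P [set v], P [set v'], x.1 v & x.1 v'].

Definition toric_morphism v (phi : P1 C -> X0_point) : Prop :=
  (forall p, in_X0v v (phi p)) /\
  forall tau, P tau -> tau v ->
    let A := [set p | in_chart v tau (phi p)] in
    zariski_open A /\
    forall m,
      (forall y, tau y -> lattice_pairing m v <= lattice_pairing m y) ->
      regular_on A (fun p => (phi p).2 m).

Definition torically_transverse v (phi : P1 C -> X0_point) : Prop :=
  (forall p, dim_le1 (phi p).1) /\
  (forall A : set (P1 C), zariski_open A -> A !=set0 ->
     exists2 p, A p & in_big_torus v (phi p)).

(* The cell tau is one-dimensional and tau - v generates the ray of u. *)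
Definition ray_cell v u tau : Prop :=
  [/\ tau v, forall y, tau y -> ray u (y - v) & exists2 y, tau y & y != v].

(* phi meets at p, with multiplicity k, the toric divisor of X_{0,v} given by the
   ray of u: when <m, u> = 1, the monomial m is a local equation of this divisor
   in the chart of the ray. *)
Definition meets_divisor v (u : 'cV[int]_n) (phi : P1 C -> X0_point) p (k : nat) :
    Prop :=
  ray_cell v (map_mx intr u) (phi p).1 /\
  forall m : 'rV[int]_n, (m *m u) 0 0 = 1 ->
    vanishing_order (fun q => (phi q).2 m) p k.

Definition pullback (phi : P1 C -> X0_point) m : ratfun C :=
  xget 0 [set g | exists A, [/\ zariski_open A, A !=set0 &
                     agrees_on A (fun q => (phi q).2 m) g]].

End CentralFibre.

(* A map to X_0 from the nodal curve whose components are projective lines indexed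
   by the vertices of T; the point of [component V] given by a flag at V is
   [flag_point], and the two flag points of a bounded edge are glued to a node. *)
Record nodal_map (R : realType) (n : nat) (T : tropical n) := NodalMap {
  flag_point : flag T -> P1 R[i];
  component : vertex T -> P1 R[i] -> X0_point R n }.

Section PreLogCurves.
Variables (R : realType) (n : nat).
Local Notation C := R[i].

Section OneCurve.
(* To be used with T the contraction of a tropical curve. *)
Variables (T : tropical n) (P : set (set 'cV[R]_n)) (phi : nodal_map R T).
Local Notation x_ := (flag_point phi).
Local Notation phi_ := (component phi).

Definition prelog_curve : Prop :=
  [/\ injective (fun f : flag T => (fv f, x_ f)),
      forall f f', opposite f f' -> phi_ (fv f) (x_ f) = phi_ (fv f') (x_ f'),
      forall V, toric_morphism P (posR R V) (phi_ V),
      forall V, torically_transverse P (posR R V) (phi_ V)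
    & forall V p, in_double_locus P (phi_ V p) ->
        exists f f' : flag T,
          [/\ opposite f f', fv f = V, x_ f = p, posR R (fv f) != posR R (fv f')
            & exists (u u' : 'cV[int]_n) (k : nat), [/\ primitive u, primitive u',
                meets_divisor (posR R (fv f)) u (phi_ (fv f)) (x_ f) k
              & meets_divisor (posR R (fv f')) u' (phi_ (fv f')) (x_ f') k]]].

Definition of_type : Prop :=
  [/\ forall V, exists p q, phi_ V p <> phi_ V q,
      forall V p, ~ in_big_torus P (posR R V) (phi_ V p) <->
        exists2 f : flag T, fv f = V & x_ f = p
    & forall f : flag T,
        meets_divisor (posR R (fv f)) (dir (fe f) (fs f)) (phi_ (fv f)) (x_ f)
          (weight (fe f))].

(* Rational sections of N_C^\vee tensor omega: on each component, a row of rational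
   1-forms. *)
Definition form_section := vertex T -> 'rV[ratfun C]_n.

(* Global sections of N_C^\vee tensor the dualizing sheaf. *)
Definition dualizing_section (s : form_section) : Prop :=
  [/\ forall V p i,
        (forall f : flag T, fv f = V -> bounded (fe f) -> x_ f <> p) ->
        regular_form (s V 0 i) p,
      forall (f : flag T) i, bounded (fe f) -> log_form (s (fv f) 0 i) (x_ f)
    & forall (f f' : flag T) i, opposite f f' ->
        residue (s (fv f) 0 i) (x_ f) + residue (s (fv f') 0 i) (x_ f') = 0].

(* H^0(C_0, N_phi^\vee tensor omega). The dual of the cokernel of the inclusion of
   Theta_{C_0} in N tensor O is the kernel of m |-> d log phi^* chi^m; tensoring with
   the line bundle omega, it is cut out by the vanishing of the image in
   omega(sum x_k) tensor omega, which can be tested on each component. *)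
Definition H_space (s : form_section) : Prop :=
  dualizing_section s /\
  forall V, \sum_(i < n) s V 0 i * dlog (pullback (phi_ V) (delta_mx 0 i)) = 0.

Definition flag_data := flag T -> 'rV[C]_n.

Definition residues (s : form_section) : flag_data :=
  fun f => \row_i residue (s (fv f) 0 i) (x_ f).

(* For each vertex q of valence at least 4, [infty q] is the flag playing the role of
   (q, E_{r+2}), [zeta_ q] is the coordinate zeta on the component of q, and [p_ f]
   is the zeta-coordinate of the point of any other flag f at q. *)
Definition affine_coordinates (infty : vertex T -> flag T)
    (zeta_ : vertex T -> 'M[C]_2) (p_ : flag T -> C) : Prop :=
  forall q : vertex T, (4 <= valence q)%N ->
    [/\ fv (infty q) = q, \det (zeta_ q) != 0,
        moebius (zeta_ q) (x_ (infty q)) = None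
      & forall f, fv f = q -> f != infty q ->
          moebius (zeta_ q) (x_ f) = Some (p_ f)].

End OneCurve.

Section Conditions.
Variables (T : tropical n) (infty : vertex T -> flag T) (p_ : flag T -> C).
Implicit Type u : flag T -> 'rV[C]_n.

Definition dirC (e : edge T) (b : bool) : 'cV[C]_n := map_mx intr (dir e b).

(* U_m for the chain l_m through e *)
Definition chain_span (e : edge T) : {vspace 'cV[C]_n} :=
  <<[seq dirC e' false | e' <- enum (chain e)]>>%VS.

Definition annihilates (a : 'rV[C]_n) (U : {vspace 'cV[C]_n}) : Prop :=
  forall y, y \in U -> a *m y = 0.

Definition condI u : Prop :=
  forall f : flag T, fe f \notin loop_part T -> u f = 0.

Definition condII u : Prop :=
  forall f : flag T, fe f \in loop_part T -> annihilates (u f) (chain_span (fe f)).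

Definition flag_sum u (p : vertex T) : 'rV[C]_n := \sum_(f : flag T | fv f == p) u f.

Definition condIIIa u : Prop := forall p : vertex T, valence p = 3 -> flag_sum u p = 0.

Definition two_valent_cond u : Prop :=
  forall p : vertex T, valence p = 2 -> flag_sum u p = 0.

(* The flags at q other than [infty q] take the place of the indices 1, ..., r+1. *)
Definition finite_flag (q : vertex T) (f : flag T) : bool :=
  (fv f == q) && (f != infty q).

Definition a_ u (f g : flag T) : C :=
  (weight (fe f))%:R * (u g *m dirC (fe f) (fs f)) 0 0.

Definition P_poly u (q : vertex T) : {poly C} :=
  \sum_(f | finite_flag q f) \sum_(g | finite_flag q g && (g != f))
    a_ u f g *: \prod_(l | [&& finite_flag q l, l != f & l != g]) ('X - (p_ l)%:P).

Definition condIIIb u : Prop :=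
  forall (q : vertex T) (r : nat), (2 <= r)%N -> valence q = (r + 2)%N ->
    [/\ u (infty q) = - \sum_(f | finite_flag q f) u f,
        forall f, finite_flag q f -> a_ u f f = 0
      & forall k, (k < r)%N -> (P_poly u q)`_k = 0].

Definition condIIIc u : Prop :=
  forall f f' : flag T, opposite f f' -> fe f \in loop_part T -> u f + u f' = 0.

Definition condIII u : Prop :=
  [/\ condIIIa u, condIIIb u, condIIIc u & two_valent_cond u].

End Conditions.
End PreLogCurves.

(* Main.v *)
Require Import Defs.
From HB Require Import structures.
From mathcomp Require Import all_boot all_order all_algebra.
From mathcomp Require Import fraction generic_quotient.
From mathcomp Require Import boolp classical_sets cardinality reals complex.
From mathcomp Require Import ring zify.
Import Order.TTheory GRing.Theory Num.Theory.

Set Implicit Arguments.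
Unset Strict Implicit.
Unset Printing Implicit Defensive.

Local Open Scope ring_scope.

(* A section of the dualizing sheaf restricts on each component to a form with
   simple poles at the flag points, hence is determined by its residues u, whose
   sum at each vertex vanishes; likewise dlog of the monomial m has residue
   w_f <m, n_f> at the flag f, because only monomials with <m, n_f> = 1 need to be
   examined and the residue is additive in m.  With a f g = w_f <u_g, n_f>, the
   condition defining H at a vertex reads
     sum_(f, g) a f g / ((zeta - x_f) (zeta - x_g)) = 0.
   Splitting into partial fractions, this means a f f = 0 and, with
   b f g = a f g + a g f, sum_(g <> f) b f g / (x_f - x_g) = 0 for every f.  In
   homogeneous coordinates, with [ , ] the determinant of two vectors, the latter is
   the vanishing for all vectors e of sum_(g <> f) b f g [e, x_g] / [x_f, x_g], which
   is invariant under Moebius transformations, so it can be tested in the coordinate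
   used for P; there the sums are, up to nonzero factors, the values of P at the
   points p_f.  At vertices of valence at most 3, b = 0 as its row sums vanish.
   A bridge carries no residue, by summing over all flags on one side of it;
   residues are constant up to sign along a chain, so that a f f = 0 along the chain
   is condition (II). *)

(** * Sums of polar terms *)

Section Residues.
Variables (C : numClosedFieldType) (I : finType) (S : pred I).

Lemma sum_offdiag_sym (A : nmodType) (G : I -> I -> A) :
  \sum_(i | S i) \sum_(j | S j && (j != i)) G i j =
  \sum_(i | S i) \sum_(j | S j && (j != i)) G j i.
Proof.
rewrite (exchange_big_dep S) /=; last by move=> i j _ /andP[].
apply: eq_bigr => i Si; apply: eq_bigl => j; rewrite Si (eq_sym i).
by case: (S j).
Qed.

(** Partial fractions in abstract form: exchanging the names of i and j in the second half collects
    the coefficient of each [m i]. It serves both for products of poles and for products of linear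
    factors missing two of them. *)
Lemma sum_offdiag_split (A : comNzRingType) (sc : {rmorphism C -> A})
    (a k : I -> I -> C) (m : I -> A) (mm : I -> I -> A) :
  (forall i j, S i -> S j -> j != i -> mm i j = sc (k i j) * m i + sc (k j i) * m j) ->
  \sum_(i | S i) \sum_(j | S j && (j != i)) sc (a i j) * mm i j =
  \sum_(i | S i) sc (\sum_(j | S j && (j != i)) (a i j + a j i) * k i j) * m i.
Proof.
move=> h.
transitivity (\sum_(i | S i) \sum_(j | S j && (j != i)) sc (a i j) * (sc (k i j) * m i)
  + \sum_(i | S i) \sum_(j | S j && (j != i)) sc (a i j) * (sc (k j i) * m j)).
  rewrite -big_split; apply: eq_bigr => i Si; rewrite -big_split; apply: eq_bigr => j /andP[Sj ji].
  by rewrite h // mulrDr.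
rewrite [X in _ + X]sum_offdiag_sym -big_split; apply: eq_bigr => i Si.
rewrite -big_split rmorph_sum mulr_suml; apply: eq_bigr => j _ /=.
by rewrite rmorphM rmorphD -mulrA -mulrDl.
Qed.

Definition cross (u v : C * C) : C := u.1 * v.2 - u.2 * v.1.

Definition hcoord (p : P1 C) : C * C := if p is Some z then (z, 1) else (1, 0).

Lemma cross_hcoord_neq0 p q : p != q -> cross (hcoord p) (hcoord q) != 0.
Proof.
case: p q => [z|] [w|] //=; rewrite /cross /=.
- by move=> zw; rewrite mulr1 mul1r subr_eq0; apply: contraNneq zw => ->.
- by rewrite mulr0 mulr1 sub0r oppr_eq0 oner_neq0.
- by rewrite mul0r subr0 mulr1 oner_neq0.
Qed.

Variable b : I -> I -> C.
Hypothesis b_sym : forall i j, b i j = b j i.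

(** Linear in [eta], unchanged when a [v j] with j <> i is rescaled, and divided by the scalar when
    [v i] is: vectors may therefore stand for points of the projective line. *)
Definition polar_sum (v : I -> C * C) i (eta : C * C) : C :=
  \sum_(j | S j && (j != i)) b i j * (cross eta (v j) / cross (v i) (v j)).

(** Since (1, 0) has determinant 1 with (z, 1) and 0 with itself, at a finite point this is the sum
    of b i j / (x i - x j) over the other finite points. *)
Definition finite_residue x i := polar_sum (hcoord \o x) i (1, 0).

(** At [eta] = [v i] every quotient is 1, which leaves the row sum without its diagonal entry. *)
Lemma polar_sum_diag v i : S i -> (forall j, S j -> j != i -> cross (v i) (v j) != 0) ->
  \sum_(j | S j) b i j = 0 -> polar_sum v i (v i) = - b i i.
Proof.
move=> Si h; rewrite (bigD1 i) //= => /eqP; rewrite addrC addr_eq0 => /eqP <-.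
apply: eq_bigr => j /andP[Sj ji].
by rewrite divff ?mulr1 // h.
Qed.

Lemma polar_sumD v i e f : polar_sum v i (e + f) = polar_sum v i e + polar_sum v i f.
Proof.
rewrite /polar_sum -big_split; apply: eq_bigr => j _ /=.
by rewrite /cross /=; ring.
Qed.

Lemma polar_sumZ v i c (e : C * C) : polar_sum v i (c * e.1, c * e.2) = c * polar_sum v i e.
Proof.
rewrite /polar_sum mulr_sumr; apply: eq_bigr => j _ /=.
by rewrite /cross /=; ring.
Qed.

(* Exchanging i and j turns the double sum into its opposite. *)
Lemma polar_sum_skew v e : 
  \sum_(i | S i) polar_sum v i e * cross e (v i) = 0.
Proof.
set M := LHS; suff : M = - M.
  by move/eqP; rewrite -addr_eq0 -mulr2n mulrn_eq0 /= => /eqP.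
transitivity (\sum_(i | S i) \sum_(j | S j && (j != i))
    b i j * (cross e (v j) / cross (v i) (v j)) * cross e (v i)).
  by apply: eq_bigr => i _; rewrite mulr_suml.
rewrite sum_offdiag_sym /M -sumrN; apply: eq_bigr => i Si.
rewrite mulr_suml -sumrN; apply: eq_bigr => j _; rewrite b_sym.
have -> : cross (v j) (v i) = - cross (v i) (v j) by rewrite /cross; ring.
by rewrite invrN; ring.
Qed.

(** A linear form on the plane that vanishes on a basis is zero; the coordinates of [eta] come from
    Cramer's rule. *)
Lemma polar_sum_eq0 (v : I -> C * C) i (e f : C * C) : cross e f != 0 ->
  polar_sum v i e = 0 -> polar_sum v i f = 0 -> forall eta, polar_sum v i eta = 0.
Proof.
move=> ef ze zf eta.
have -> : eta = ((cross eta f / cross e f) * e.1, (cross eta f / cross e f) * e.2)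
             + ((cross e eta / cross e f) * f.1, (cross e eta / cross e f) * f.2).
  move: ef; case: e f eta {ze zf} => [e1 e2] [f1 f2] [t1 t2]; rewrite /cross /= => ef.
  by apply/pair_equal_spec; split; rewrite /=; field.
by rewrite polar_sumD !polar_sumZ ze zf !mulr0 addr0.
Qed.

(* The diagonal term and the residue at a point at infinity are not given; they are
   recovered from polar_sum_skew for two vectors e. *)
Lemma finite_residues_polar_sum (x : I -> P1 C) : {in S &, injective x} ->
  (forall i, S i -> \sum_(j | S j) b i j = 0) ->
  (forall i, S i -> x i <> None -> b i i = 0 /\ finite_residue x i = 0) <->
  (forall i, S i -> b i i = 0 /\ forall e, polar_sum (hcoord \o x) i e = 0).
Proof.
move=> x_inj s0; split=> h; last first.
  by move=> i Si _; have [? ?] := h i Si; split=> //; apply: (h i Si).2.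
have dg i : S i -> polar_sum (hcoord \o x) i (hcoord (x i)) = - b i i.
  move=> Si; apply: (polar_sum_diag (v := hcoord \o x)) => // [j Sj ji|]; last exact: s0.
  by apply: cross_hcoord_neq0; rewrite (inj_in_eq x_inj) // eq_sym.
(* At a finite point the form vanishes on (1, 0) by assumption and on the vector of the point
   because [b i i] = 0; these two vectors are independent. *)
have fin i : S i -> x i <> None -> b i i = 0 /\ forall e, polar_sum (hcoord \o x) i e = 0.
  move=> Si xi; have [bi ri] := h i Si xi; split=> //.
  apply: (@polar_sum_eq0 _ _ (1, 0) (hcoord (x i))) => //.
    by case: (x i) xi => // z _; rewrite /cross /= mul0r subr0 mulr1 oner_neq0.
  by rewrite dg // bi oppr0.
move=> i Si; have [xi|xi] := pselect (x i = None); last exact: fin.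
(* With [x i] infinite, the skew identity reduces to the term of i, so the polar sum vanishes at
   every e independent of (1, 0). *)
have M e : polar_sum (hcoord \o x) i e * cross e (1, 0) = 0.
  rewrite -[RHS](polar_sum_skew (hcoord \o x) e) [RHS](bigD1 i) //= xi big1 ?addr0 //.
  move=> j /andP[Sj ji]; rewrite (fin j Sj _).2 ?mul0r //.
  by move=> xj; move/eqP: ji; apply; apply: x_inj => //; rewrite xi.
have W1 : polar_sum (hcoord \o x) i (0, 1) = 0.
  by have := M (0, 1); rewrite /cross /= mul0r mul1r sub0r mulrN1 => /eqP; rewrite oppr_eq0 => /eqP.
have W2 : polar_sum (hcoord \o x) i (1, 1) = 0.
  by have := M (1, 1); rewrite /cross /= mulr0 mul1r sub0r mulrN1 => /eqP; rewrite oppr_eq0 => /eqP.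
have W e : polar_sum (hcoord \o x) i e = 0.
  by apply: (@polar_sum_eq0 _ _ (0, 1) (1, 1)); rewrite // /cross /= mul0r mulr1 sub0r oppr_eq0 oner_neq0.
by split=> //; apply/eqP; rewrite -oppr_eq0 -dg // W.
Qed.

End Residues.

(** * Moebius transformations *)

Section Moebius.
Variables (C : numClosedFieldType).

Definition linear_act (A : 'M[C]_2) (e : C * C) : C * C :=
  (A 0 0 * e.1 + A 0 1 * e.2, A 1 0 * e.1 + A 1 1 * e.2).

Lemma det2 (A : 'M[C]_2) : \det A = A 0 0 * A 1 1 - A 0 1 * A 1 0.
Proof.
rewrite (expand_det_row _ ord0) !big_ord_recl big_ord0 addr0 /cofactor /=.
rewrite !det_mx11 !mxE /= expr0 expr1 mul1r mulN1r mulrN.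
by congr (A _ _ * A _ _ - A _ _ * A _ _); apply: val_inj.
Qed.

Lemma cross_linear_act A e f : cross (linear_act A e) (linear_act A f) = \det A * cross e f.
Proof. by rewrite det2 /cross /=; ring. Qed.

(** The factor [k] is the denominator of the fraction, or its numerator when the image is
    infinite. *)
Lemma hcoord_moebius A p : \det A != 0 -> exists2 k, k != 0 &
  linear_act A (hcoord p) = (k * (hcoord (moebius A p)).1, k * (hcoord (moebius A p)).2).
Proof.
move=> dA; rewrite /moebius.
have -> : (if p is Some z then (z, 1) else (1, 0)) = hcoord p by [].
case E : (hcoord p) => [x y] /=; case: eqP => [d0|/eqP d0] /=; last first.
  by exists (A 1 0 * x + A 1 1 * y) => //; rewrite /linear_act /= mulr1 [_ * (_ / _)]mulrC divfK.
exists (A 0 0 * x + A 0 1 * y); last by rewrite /linear_act /= mulr1 mulr0 d0.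
(* If the numerator vanished too, A would kill a nonzero vector; multiplying by the adjugate then
   gives det A = 0. *)
apply: contraNneq dA => n0.
have xy : (x != 0) || (y != 0).
  by case: p E => [z|] /= [<- <-]; rewrite oner_neq0 ?orbT.
have dx : \det A * x = 0.
  rewrite det2.
  transitivity (A 1 1 * (A 0 0 * x + A 0 1 * y) - A 0 1 * (A 1 0 * x + A 1 1 * y)); first by ring.
  by rewrite n0 d0 !mulr0 subrr.
have dy : \det A * y = 0.
  rewrite det2.
  transitivity (A 0 0 * (A 1 0 * x + A 1 1 * y) - A 1 0 * (A 0 0 * x + A 0 1 * y)); first by ring.
  by rewrite n0 d0 !mulr0 subrr.
by case/orP: xy => /negPf xy; move/eqP: dx; move/eqP: dy; rewrite !mulf_eq0 xy orbF // => _ /eqP. 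
Qed.

(** Distinctness of points is the non-vanishing of a determinant, which the linear action multiplies
    by det A. *)
Lemma moebius_inj (A : 'M[C]_2) : \det A != 0 -> injective (moebius A).
Proof.
move=> dA p q E; apply/eqP; apply: contraT => /cross_hcoord_neq0.
have [k k0 kE] := hcoord_moebius p dA; have [l l0 lE] := hcoord_moebius q dA.
rewrite -(inj_eq (mulfI dA)) mulr0 -cross_linear_act kE lE E /cross /=.
have -> : forall k l x y : C, k * x * (l * y) - k * y * (l * x) = 0 by move=> *; ring.
by rewrite eqxx.
Qed.

(** The linear action multiplies all determinants by det A, and normalising the coordinates rescales
    the vectors. In total the form changes by the factor [k i] and by the invertible substitution of
    A e for e. *)
Lemma polar_sum_moebius (I : finType) (S : pred I) (b : I -> I -> C) (x : I -> P1 C)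
    (A : 'M[C]_2) i :
  \det A != 0 -> (forall e, polar_sum S b (@hcoord C \o x) i e = 0) <->
   (forall e, polar_sum S b (@hcoord C \o (moebius A \o x)) i e = 0).
Proof.
move=> dA.
have /boolp.choice[k hk] : forall j, exists k, k != 0 /\ linear_act A (hcoord (x j)) =
   (k * (hcoord (moebius A (x j))).1, k * (hcoord (moebius A (x j))).2).
  by move=> j; have [l] := hcoord_moebius (x j) dA; exists l.
have E e : polar_sum S b (@hcoord C \o x) i e * k i = 
    polar_sum S b (@hcoord C \o (moebius A \o x)) i (linear_act A e).
  rewrite /polar_sum mulr_suml; apply: eq_bigr => j _; rewrite -mulrA; congr (_ * _).
  have [ki Ei] := hk i; have [kj Ej] := hk j.
  have -> : cross e ((@hcoord C \o x) j) / cross ((@hcoord C \o x) i) ((@hcoord C \o x) j) =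
    cross (linear_act A e) (linear_act A (hcoord (x j))) /
    cross (linear_act A (hcoord (x i))) (linear_act A (hcoord (x j))).
    by rewrite !cross_linear_act -mulf_div divff // mul1r.
  rewrite Ei Ej /=; move: (hcoord (moebius _ (x i))) (hcoord (moebius _ (x j))) (linear_act A e).
  move=> [u1 u2] [v1 v2] [w1 w2]; rewrite /cross /=.
  have -> : k i * u1 * (k j * v2) - k i * u2 * (k j * v1) = (k i * k j) * (u1 * v2 - u2 * v1) by ring.
  have -> : w1 * (k j * v2) - w2 * (k j * v1) = k j * (w1 * v2 - w2 * v1) by ring.
  rewrite !invfM; move: (_ - _)^-1 => t; by field; rewrite ki kj.
have [ki _] := hk i.
split=> h e; last first.
  by have := E e; rewrite h => /eqP; rewrite mulf_eq0 (negPf ki) orbF => /eqP.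
(* The preimage of e, written with the adjugate of A. *)
have -> : e = linear_act A ((A 1 1 * e.1 - A 0 1 * e.2) / \det A, (A 0 0 * e.2 - A 1 0 * e.1) / \det A).
  rewrite det2 in dA *; case: e => e1 e2; rewrite /linear_act /=; apply/pair_equal_spec.
  by split; field.
by rewrite -E h mul0r.
Qed.

End Moebius.

(** * The polynomial P and its Lagrange form *)

Section Polynomial.
Variables (C : numClosedFieldType) (I : finType) (S : pred I) (a : I -> I -> C) (z : I -> C).
Hypothesis z_inj : {in S &, injective z}.

(** [P_poly] over an abstract index set; the two are convertible. *)
Definition offdiag_poly : {poly C} := \sum_(i | S i) \sum_(j | S j && (j != i))
  a i j *: \prod_(l | [&& S l, l != i & l != j]) ('X - (z l)%:P).

(** As (X - z_j) - (X - z_i) = z_i - z_j, a product missing the factors i and j is a combination of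
    the products missing just one of them. *)
Lemma offdiag_polyE : offdiag_poly = \sum_(i | S i)
  (\sum_(j | S j && (j != i)) (a i j + a j i) * (z i - z j)^-1)%:P
    * \prod_(l | S l && (l != i)) ('X - (z l)%:P).
Proof.
under [LHS]eq_bigr do under eq_bigr do rewrite -mul_polyC.
apply: (sum_offdiag_split (sc := polyC)) => i j Si Sj ji.
have zij : z i - z j != 0 by rewrite subr_eq0 (inj_in_eq z_inj) // eq_sym.
rewrite [\prod_(l | S l && (l != i)) _](bigD1 j) ?Sj //=.
rewrite [\prod_(l | S l && (l != j)) _](bigD1 i) ?Si 1?eq_sym //=.
have -> : \prod_(l | S l && (l != j) && (l != i)) ('X - (z l)%:P) =
   \prod_(l | S l && (l != i) && (l != j)) ('X - (z l)%:P).
  by apply: eq_bigl => l; rewrite andbAC.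
have -> : \prod_(l | [&& S l, l != i & l != j]) ('X - (z l)%:P) =
   \prod_(l | S l && (l != i) && (l != j)) ('X - (z l)%:P).
  by apply: eq_bigl => l; rewrite andbA.
rewrite !mulrA -mulrDl -[LHS]mul1r; congr (_ * _).
rewrite -(opprB (z i)) invrN polyCN mulNr -mulrBr.
have -> : 'X - (z j)%:P - ('X - (z i)%:P) = (z i - z j)%:P by rewrite polyCB; ring.
by rewrite -polyCM mulVf.
Qed.

(** Evaluation of the Lagrange form at z_i leaves only the i-th coefficient, times a nonzero
    product. *)
Lemma offdiag_poly_eq0 : offdiag_poly = 0 <->
  forall i, S i -> \sum_(j | S j && (j != i)) (a i j + a j i) * (z i - z j)^-1 = 0.
Proof.
rewrite offdiag_polyE; split=> [h i Si|h]; last first.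
  by apply: big1 => i Si; rewrite h // polyC0 mul0r.
have := congr1 (horner^~ (z i)) h.
rewrite horner0 horner_sum (bigD1 i) //= [X in _ + X = _]big1 ?addr0; last first.
  move=> j /andP[Sj ji]; rewrite hornerM horner_prod [X in _ * X](bigD1 i) /=.
    by rewrite hornerXsubC subrr mul0r mulr0.
  by rewrite Si eq_sym.
rewrite hornerM hornerC => /eqP; rewrite mulf_eq0 => /orP[/eqP //|].
rewrite horner_prod => /eqP E; have : \prod_(l | S l && (l != i)) ('X - (z l)%:P).[z i] != 0.
  apply/prodf_neq0 => l /andP[Sl li].
  by rewrite hornerXsubC subr_eq0 (inj_in_eq z_inj) // eq_sym.
by rewrite E eqxx.
Qed.

(** Each product has #|S| - 2 linear factors, hence size #|S| - 1. With the r + 1 finite flags of an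
    (r + 2)-valent vertex, only the coefficients of index below r remain. *)
Lemma size_offdiag_poly : (size offdiag_poly <= #|S|.-1)%N.
Proof.
rewrite (leq_trans (size_sum _ _ _)) //; apply/bigmax_leqP => i Si.
rewrite (leq_trans (size_sum _ _ _)) //; apply/bigmax_leqP => j /andP[Sj ji].
rewrite (leq_trans (size_scale_leq _ _)) // -big_filter size_prod_XsubC size_filter.
have [Si' Sj'] : i \in S /\ j \in S by [].
rewrite -sum1_count (cardD1 i) (cardD1 j) -sum1_card !inE Si' Sj' ji /= addnA add1n /=.
apply: eq_leq; congr _.+1; apply: eq_bigl => l; rewrite !inE.
by rewrite -[l \in S]/(S l); case: (S l); rewrite ?andbF ?andbT //= andbC.
Qed.

End Polynomial.

(** * Rational functions and forms on the projective line *)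

(* The notions of Defs over an arbitrary fraction field iota : C[X] -> F, into which
   they convert for F = ratfun C: the quotient defining {fraction {poly C}} makes
   unification and the field tactic diverge. *)
Section RationalFunctions.
Variables (C : numClosedFieldType) (F : fieldType) (iota : {rmorphism {poly C} -> F}).
Local Notation "x %:F" := (iota x) (only parsing) : ring_scope.
Hypothesis iota_inj : injective iota.
Hypothesis fracE : forall g : F, exists a b : {poly C}, b != 0 /\ g = a%:F / b%:F.
Implicit Types (g h : F) (p : P1 C) (c : C) (r b : {poly C}).

Lemma iota_eq0 r : (r%:F == 0) = (r == 0).
Proof. by rewrite -(rmorph0 iota) (inj_eq iota_inj). Qed.

Definition value g p c : Prop :=
  exists a b : {poly C}, b != 0 /\ g = a%:F / b%:F /\
    match p with
    | Some z => b.[z] != 0 /\ c = a.[z] / b.[z]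
    | None => (size a <= size b)%N /\ c = a`_(size b).-1 / lead_coef b
    end.

Local Notation zt := ('X%:F).
Definition const c : F := (c%:P)%:F.

Lemma const_is_additive : zmod_morphism const.
Proof. by move=> c d; rewrite /const !rmorphB. Qed.
Lemma const_is_multiplicative : monoid_morphism const.
Proof. by split=> [|c d]; rewrite /const ?rmorphM ?rmorph1. Qed.
HB.instance Definition _ := GRing.isZmodMorphism.Build C F const const_is_additive.
HB.instance Definition _ := GRing.isMonoidMorphism.Build C F const const_is_multiplicative.

Definition param p : F := if p is Some z then zt - const z else zt^-1.
Definition dzeta p : F := if p is Some _ then 1 else - zt ^+ 2.
Definition regular g p := exists c, value (g * dzeta p) p c.
Definition log_part g p : F := g * dzeta p * param p.

Lemma iotaZ c b : (c *: b)%:F = const c * b%:F.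
Proof. by rewrite -mul_polyC rmorphM. Qed.

(** Says that r / b is regular at p with value 0; at infinity this is a comparison of degrees. *)
Definition vanishes p (r b : {poly C}) : Prop :=
  if p is Some z then b.[z] != 0 /\ r.[z] = 0 else (size r < size b)%N.

(** Splitting off the value as a constant treats finite points and infinity alike, and makes the
    rules for sums and products formal. *)
Lemma valueP g p c : value g p c <->
  exists r b, [/\ b != 0, g = const c + r%:F / b%:F & vanishes p r b].
Proof.
split=> [[a [b [b0 [-> h]]]]|[r [b [b0 -> h]]]].
  have b0' : b%:F != 0  by rewrite iota_eq0.
  exists (a - c *: b), b; split=> //.
    by rewrite rmorphB iotaZ mulrBl mulfK // addrC subrK.
  case: p h => [z [bz ->]|[sab ->]] /=.
    by split=> //; rewrite hornerD hornerN hornerZ mulfVK // subrr.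
  set k := _ / _.
  have lb : lead_coef b != 0 by rewrite lead_coef_eq0.
  have sb : (0 < size b)%N by rewrite size_poly_gt0.
  apply: leq_ltn_trans (_ : (size b).-1 < _)%N; last by rewrite prednK.
  apply/leq_sizeP => j hj; rewrite coefB coefZ.
  move: hj; rewrite leq_eqVlt => /orP[/eqP <-|hj].
    by rewrite /k -lead_coefE mulfVK // subrr.
  have hj' : (size b <= j)%N by rewrite -(prednK sb).
  by rewrite !nth_default ?(mulr0, subr0) // (leq_trans sab).
have b0' : b%:F != 0  by rewrite iota_eq0.
exists (c *: b + r), b; split=> //; split.
  by rewrite rmorphD iotaZ [RHS]mulrDl mulfK.
case: p h => [z [bz rz]|srb] /=.
  by split=> //; rewrite hornerD hornerZ rz addr0 mulfK.
split.
  rewrite (leq_trans (size_polyD _ _)) // geq_max size_scale_leq /=.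
  exact: ltnW.
rewrite coefD coefZ -lead_coefE (@nth_default _ _ r) ?addr0 ?mulfK ?lead_coef_eq0 //.
by rewrite -ltnS prednK // size_poly_gt0.
Qed.

Lemma vanishesM p r b r' b' : b != 0 -> b' != 0 -> vanishes p r b -> vanishes p r' b' ->
  vanishes p (r * b') (b * b').
Proof.
case: p => [z|] /= b0 b0'.
  by move=> [bz rz] [b'z r'z]; rewrite !hornerM rz mul0r mulf_neq0.
move=> h _; have [->|r0] := eqVneq r 0.
  by rewrite mul0r size_poly0 size_poly_gt0 mulf_neq0.
rewrite !size_mul //; move: h b0'; rewrite -size_poly_gt0; move: (size r) (size b) (size b') => x y z; lia.
Qed.

Lemma vanishesD p r r' b : vanishes p r b -> vanishes p r' b -> vanishes p (r + r') b.
Proof.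
case: p => [z|] /=; first by move=> [bz rz] [_ r'z]; rewrite hornerD rz r'z addr0.
by move=> h h'; rewrite (leq_ltn_trans (size_polyD _ _)) // gtn_max h.
Qed.

Lemma vanishesZ p c r b : vanishes p r b -> vanishes p (c *: r) b.
Proof.
case: p => [z|] /=; first by move=> [bz rz]; rewrite hornerZ rz mulr0.
exact: leq_ltn_trans (size_scale_leq _ _).
Qed.

Lemma vanishes_mul p r b r' b' : b != 0 -> b' != 0 -> vanishes p r b -> vanishes p r' b' ->
  vanishes p (r * r') (b * b').
Proof.
case: p => [z|] /= b0 b0'.
  by move=> [bz rz] [b'z r'z]; rewrite !hornerM rz mul0r mulf_neq0.
move=> h h'; have [->|r0] := eqVneq r 0.
  by rewrite mul0r size_poly0 size_poly_gt0 mulf_neq0.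
have [->|r0'] := eqVneq r' 0.
  by rewrite mulr0 size_poly0 size_poly_gt0 mulf_neq0.
rewrite !size_mul //; move: h h' b0' b0 r0 r0'; rewrite -!size_poly_gt0.
move: (size r) (size r') (size b) (size b') => x y z t; lia.
Qed.

Lemma valueD g h p c (d : C) :
  value g p c -> value h p d -> value (g + h) p (c + d).
Proof.
move=> /valueP[r [b [b0 -> v]]] /valueP[r' [b' [b0' -> v']]].
have bF : b%:F != 0  by rewrite iota_eq0.
have bF' : b'%:F != 0  by rewrite iota_eq0.
apply/valueP; exists (r * b' + r' * b), (b * b'); split; first exact: mulf_neq0.
  by rewrite rmorphD rmorphD !rmorphM -addf_div // addrACA.
apply: vanishesD; first exact: vanishesM v v'.
by rewrite (mulrC b); apply: vanishesM v' v.
Qed.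

Lemma valueM g h p c (d : C) :
  value g p c -> value h p d -> value (g * h) p (c * d).
Proof.
move=> /valueP[r [b [b0 -> v]]] /valueP[r' [b' [b0' -> v']]].
have bF : b%:F != 0  by rewrite iota_eq0.
have bF' : b'%:F != 0  by rewrite iota_eq0.
apply/valueP; exists (d *: (r * b') + c *: (r' * b) + r * r'), (b * b').
split; first exact: mulf_neq0.
  have E (K : fieldType) (x y z w t u : K) : z != 0 -> u != 0 ->
    (x + y / z) * (w + t / u) = x * w + (w * (y * u) + x * (t * z) + y * t) / (z * u).
    by move=> z0 u0; field; rewrite z0 u0.
  by rewrite E // rmorphM !rmorphD !iotaZ !rmorphM.
apply: vanishesD; last exact: vanishes_mul.
apply: vanishesD; apply: vanishesZ; first exact: vanishesM v v'.
by rewrite (mulrC b); apply: vanishesM v' v.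
Qed.

Lemma value_const c p : value (const c) p c.
Proof.
apply/valueP; exists 0, 1; rewrite rmorph0 mul0r addr0 oner_eq0; split=> //.
by case: p => [z|] /=; rewrite ?hornerE ?oner_eq0 // size_poly0 size_poly1.
Qed.

Lemma value0 p : value (0 : F) p 0.
Proof. by rewrite -(rmorph0 const); apply: value_const. Qed.

Lemma valueZ g p c (d : C) : value g p c -> value (const d * g) p (d * c).
Proof. exact/valueM/value_const. Qed.

Lemma valueN g p c : value g p c -> value (- g) p (- c).
Proof.
by move=> /(valueZ (-1)); rewrite rmorphN rmorph1 /= !mulN1r.
Qed.

Lemma valueB g h p c (d : C) :
  value g p c -> value h p d -> value (g - h) p (c - d).
Proof. by move=> hg /valueN; apply: valueD. Qed.

Lemma value_sum (I : finType) (S : pred I) (g : I -> F) (c : I -> C) p :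
  (forall i, S i -> value (g i) p (c i)) ->
  value (\sum_(i | S i) g i) p (\sum_(i | S i) c i).
Proof.
move=> h; apply: (big_ind2 (fun g c => value g p c)) => //.
  exact: value0.
by move=> *; apply: valueD.
Qed.

Lemma valueV g p c : value g p c -> c != 0 -> value g^-1 p c^-1.
Proof.
move=> [a [b [b0 [-> h]]]] c0; exists b, a; rewrite invf_div.
case: p h => [z [bz cE]|[sab cE]].
  have az : a.[z] != 0 by apply: contraNneq c0 => az; rewrite cE az mul0r.
  split; first by apply: contraNneq az => ->; rewrite horner0.
  by rewrite cE invf_div.
have h : (size b <= size a)%N.
  rewrite leqNgt; apply: contraNN c0 => h.
  by rewrite cE nth_default ?mul0r // -ltnS prednK // size_poly_gt0.
have s : size a = size b by apply/eqP; rewrite eqn_leq sab.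
split; first by rewrite -size_poly_eq0 s size_poly_eq0.
by split=> //; split=> //; rewrite cE invf_div !lead_coefE s //.
Qed.

(** Expanding g - g = 0 around the value c - d gives (c - d) b + r = 0; evaluation at the point, or
    at infinity the coefficient in the degree of b, leaves c = d. *)
Lemma value_uniq g p c (d : C) : value g p c -> value g p d -> c = d.
Proof.
move=> hc hd; have := valueB hc hd; rewrite subrr.
move=> /valueP[r [b [b0 /esym E v]]].
have bF : b%:F != 0  by rewrite iota_eq0.
have : ((c - d) *: b + r)%:F = 0 .
  apply: (mulIf (invr_neq0 bF)); rewrite mul0r -E rmorphD iotaZ.
  by rewrite [LHS]mulrDl mulfK.
move/eqP; rewrite iota_eq0 => /eqP bE; apply/eqP; rewrite -subr_eq0.
apply/eqP; case: p v {hc hd} => [z [bz rz]|s] /=.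
  have := congr1 (horner^~ z) bE; rewrite horner0 hornerD hornerZ rz addr0.
  by move/eqP; rewrite mulf_eq0 (negPf bz) orbF => /eqP.
have := congr1 (fun q : {poly C} => q`_(size b).-1) bE.
rewrite coef0 coefD coefZ -lead_coefE (@nth_default _ _ r) ?addr0; last first.
  by rewrite -ltnS prednK // size_poly_gt0.
by move/eqP; rewrite mulf_eq0 lead_coef_eq0 (negPf b0) orbF => /eqP.
Qed.

Lemma zeta_sub (z : C) : zt - const z = ('X - z%:P)%:F.
Proof. by rewrite rmorphB. Qed.

Lemma value_poly (a : {poly C}) z : value a%:F (Some z) a.[z].
Proof.
exists a, 1; rewrite oner_eq0 rmorph1 divr1; split=> //; split=> //.
by rewrite !hornerE oner_eq0 divr1.
Qed.

(** Stated without division, so that b may vanish at z, in which case a vanishes there as well. *)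
Lemma value_frac (a b : {poly C}) z c : b != 0 ->
  value (a%:F / b%:F) (Some z) c -> a.[z] = c * b.[z].
Proof.
move=> b0 /valueP[r [d [d0 E [dz rz]]]].
have bF : b%:F != 0  by rewrite iota_eq0.
have dF : d%:F != 0  by rewrite iota_eq0.
have : (a * d)%:F == ((c *: d + r) * b)%:F.
  have E1 : a%:F = (const c + r%:F / d%:F) * b%:F by rewrite -E divfK.
  by rewrite !rmorphM E1 rmorphD iotaZ /= mulrAC [X in X * iota b == _]mulrDl divfK.
rewrite (inj_eq iota_inj) => /eqP/(congr1 (horner^~ z)).
rewrite !(hornerM, hornerD, hornerZ) rz addr0 => h.
by apply: (mulIf dz); rewrite h mulrAC.
Qed.

(** The form d zeta / (zeta - z) has a second pole at infinity, with residue -1; a point at infinity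
    thus needs no term of its own once the residues add up to zero. *)
Definition pole p : F := if p is Some z then (zt - const z)^-1 else 0.

Lemma zeta_sub_neq0 (z : C) : zt - const z != 0.
Proof. by rewrite zeta_sub iota_eq0 polyXsubC_eq0. Qed.

Lemma zeta_neq0 : zt != 0.
Proof. by rewrite iota_eq0 polyX_eq0. Qed.

Lemma value_zeta_sub (z x : C) : value (zt - const z) (Some x) (x - z).
Proof. by rewrite zeta_sub; have := value_poly ('X - z%:P) x; rewrite hornerXsubC. Qed.

Lemma value_pole_fin (z x : C) : x != z -> value (pole (Some z)) (Some x) (x - z)^-1.
Proof. by move=> xz; apply: valueV (value_zeta_sub _ _) _; rewrite subr_eq0. Qed.

Lemma value_zeta_pole_infty (z : C) : value (zt * pole (Some z)) None 1.
Proof.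
rewrite /= zeta_sub; exists 'X, ('X - z%:P); rewrite polyXsubC_eq0; split=> //; split=> //.
by rewrite size_polyX size_XsubC lead_coefXsubC coefX eqxx divr1.
Qed.

Lemma value_param p : value (param p) p 0.
Proof.
case: p => [z|] /=; first by rewrite -(subrr z); apply: value_zeta_sub.
exists 1, 'X; rewrite polyX_eq0 rmorph1 div1r; split=> //; split=> //.
by rewrite size_poly1 size_polyX lead_coefX coef1 /= mul0r.
Qed.

Lemma regular_log_part g p : regular g p -> value (log_part g p) p 0.
Proof.
by case=> c h; rewrite -(mulr0 c) /log_part; apply: valueM h (value_param p).
Qed.

Lemma log_partD g h p : log_part (g + h) p = log_part g p + log_part h p.
Proof. by rewrite /log_part !mulrDl. Qed.

Lemma log_partZ k g p : log_part (k * g) p = k * log_part g p.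
Proof. by rewrite /log_part !mulrA. Qed.

Lemma value_log_partB g h p c (d : C) : value (log_part g p) p c ->
  value (log_part h p) p d -> value (log_part (g - h) p) p (c - d).
Proof. by move=> hg hh; rewrite /log_part !mulrBl; apply: valueB. Qed.

Lemma value_log_partMz g p c (k : int) : value (log_part g p) p c ->
  value (log_part (g *~ k) p) p (c *~ k).
Proof.
have -> : g *~ k = const k%:~R * g by rewrite rmorph_int mulrzl.
by rewrite -[c *~ k]mulrzl log_partZ; apply: valueZ.
Qed.

(** In lowest terms, a root of the denominator would also be a root of the numerator; the field
    being algebraically closed, the denominator is constant. *)
Lemma entire_polynomial g : (forall z, exists c, value g (Some z) c) ->
  exists q : {poly C}, g = q%:F.
Proof.
move=> hg; have [a [b [b0 E]]] := fracE g.
pose d := gcdp a b; have d0 : d != 0 by rewrite gcdp_eq0 negb_and b0 orbT.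
have bF : b%:F != 0  by rewrite iota_eq0.
have dF : d%:F != 0  by rewrite iota_eq0.
have aE : a = (a %/ d) * d by rewrite divpK // dvdp_gcdl.
have bE : b = (b %/ d) * d by rewrite divpK // dvdp_gcdr.
have cop : coprimep (a %/ d) (b %/ d) by apply: coprimep_div_gcd; rewrite b0 orbT.
move: (a %/ d) (b %/ d) aE bE cop => a1 b1 aE bE cop.
have b10 : b1 != 0 by apply: contraNneq b0 => b10; rewrite bE b10 mul0r.
have b1F : b1%:F != 0  by rewrite iota_eq0.
have {}E : g = a1%:F / b1%:F.
  by rewrite E aE bE !rmorphM /=; field; rewrite b1F.
have [s1|s1] := eqVneq (size b1) 1%N; last first.
  have [z bz] := closed_rootP _ s1; have [c] := hg z.
  rewrite E => /(value_frac b10) az.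
  move: bz; rewrite /root => /eqP bz; rewrite bz mulr0 in az.
  have := coprimep_root cop (_ : root a1 z); rewrite /root az eqxx bz eqxx.
  by move=> /(_ isT).
have := size_poly1P _ => /(_ C b1); rewrite s1 eqxx => /elimT/(_ isT)[k k0 kE].
exists (k^-1 *: a1); rewrite E kE -mul_polyC rmorphM /= mulrC; congr (_ * _).
apply: (mulIf (_ : (k%:P)%:F != 0)); first by rewrite iota_eq0 polyC_eq0.
by rewrite mulVf ?iota_eq0 ?polyC_eq0 // -rmorphM -polyCM mulVf // rmorph1.
Qed.

Lemma value_div_zeta_sub g z : value ((zt - const z) * g) (Some z) 0 ->
  exists c, value g (Some z) c.
Proof.
move=> [a [b [b0 [E [bz /esym/eqP]]]]].
rewrite mulf_eq0 invr_eq0 (negPf bz) orbF => /factor_theorem [q aE].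
have bF : b%:F != 0  by rewrite iota_eq0.
exists (q.[z] / b.[z]), q, b; split=> //; split=> //.
apply: (mulfI (zeta_sub_neq0 z)); rewrite E aE rmorphM /= zeta_sub; field.
exact: bF.
Qed.

(** * Partial fractions on the projective line *)

Section PartialFractions.
Variables (I : finType) (S : pred I) (x : I -> P1 C).
Hypothesis x_inj : {in S &, injective x}.
Implicit Type rho : I -> C.

Definition polar_part rho : F := \sum_(i | S i) const (rho i) * pole (x i).

Lemma log_part_pole_fin z p : log_part (pole p) (Some z) = pole p * (zt - const z).
Proof. by rewrite /log_part /= mulr1. Qed.

Lemma value_log_part_pole (z : C) p :
  value (log_part (pole p) (Some z)) (Some z) ((p == Some z)%:R).
Proof.
rewrite log_part_pole_fin; case: p => [w|]; last first.
  by rewrite mul0r; apply: value0.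
have [[->]|ne] := eqVneq (Some w) (Some z).
  rewrite /= mulVf ?zeta_sub_neq0 // -(rmorph1 const).
  exact: value_const.
have zw : z != w by apply: contraNneq ne => ->.
rewrite mulr0n -(mulr0 (z - w)^-1) -(subrr z).
exact: valueM (value_pole_fin zw) (value_zeta_sub _ _).
Qed.

Lemma log_part_polar_part rho p : log_part (polar_part rho) p =
  \sum_(i | S i) const (rho i) * log_part (pole (x i)) p.
Proof.
by rewrite /log_part /polar_part !mulr_suml; apply: eq_bigr => i _; rewrite !mulrA.
Qed.

Lemma polar_part_finite_log_part rho i z : S i -> x i = Some z ->
  value (log_part (polar_part rho) (x i)) (x i) (rho i).
Proof.
move=> Si xi; rewrite log_part_polar_part xi.
have -> : rho i = \sum_(j | S j) rho j * ((x j == Some z)%:R).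
  rewrite (bigD1 i) //= xi eqxx mulr1 big1 ?addr0 // => j /andP[Sj ji].
  rewrite -xi (inj_in_eq x_inj) //; first by rewrite (negPf ji) mulr0.
by apply: value_sum => j _; apply/valueZ/value_log_part_pole.
Qed.

Lemma polar_part_infinite_log_part rho :
  value (log_part (polar_part rho) None) None (- \sum_(i | S i && (x i != None)) rho i).
Proof.
rewrite log_part_polar_part -sumrN big_mkcondr /=; apply: value_sum => i _.
rewrite /log_part; case: (x i) => [z|] /=; last first.
  by rewrite !mul0r mulr0; apply: value0.
have -> : const (rho i) * ((zt - const z)^-1 * - zt ^+ 2 / zt) =
   - (const (rho i) * (zt * pole (Some z))).
  by rewrite /=; field; rewrite zeta_neq0 zeta_sub_neq0.
by have := valueN (valueZ (rho i) (value_zeta_pole_infty z)); rewrite mulr1.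
Qed.

Lemma polar_part_log_part rho i : \sum_(i | S i) rho i = 0 -> S i ->
  value (log_part (polar_part rho) (x i)) (x i) (rho i).
Proof.
move=> s0 Si; case xi: (x i) => [z|].
  by rewrite -xi; apply: polar_part_finite_log_part xi.
have -> : rho i = - \sum_(i | S i && (x i != None)) rho i; last exact: polar_part_infinite_log_part.
move: s0; rewrite (bigD1 i) //= => /eqP; rewrite addr_eq0 => /eqP ->; congr (- _).
apply: eq_bigl => j; case Sj: (S j) => //=; congr negb.
by rewrite -xi (inj_in_eq x_inj).
Qed.

Lemma polar_part_regular rho p : \sum_(i | S i) rho i = 0 ->
  (forall i, S i -> x i <> p) -> regular (polar_part rho) p.
Proof.
move=> s0 h; rewrite /regular /polar_part mulr_suml.
case: p h => [z|] h /=.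
  exists (\sum_(i | S i) rho i * (if x i is Some w then (z - w)^-1 else 0)).
  apply: value_sum => i Si; rewrite mulr1; apply: valueZ.
  have := h i Si; case: (x i) => [w ne|_]; last exact: value0.
  by apply: value_pole_fin; apply: contra_notN ne => /eqP ->.
exists (\sum_(i | S i) - (rho i * odflt 0 (x i))).
(* Here zeta^2 / (zeta - w) = zeta + w zeta / (zeta - w), and the terms in zeta cancel because the
   residues add up to zero. *)
have -> : \sum_(i | S i) const (rho i) * pole (x i) * - zt ^+ 2 =
  \sum_(i | S i) - (const (rho i * odflt 0 (x i)) * (zt * pole (x i))).
  apply/eqP; rewrite -subr_eq0 -sumrB.
  have -> : \sum_(i | S i) (const (rho i) * pole (x i) * - zt ^+ 2 +
     - - (const (rho i * odflt 0 (x i)) * (zt * pole (x i)))) =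
    \sum_(i | S i) - zt * const (rho i).
    apply: eq_bigr => i Si; have := h i Si; case: (x i) => [w _|//] /=.
    rewrite rmorphM /=; field; exact: zeta_sub_neq0.
  by rewrite -mulr_sumr -rmorph_sum s0 rmorph0 mulr0.
apply: value_sum => i Si; have := h i Si; case: (x i) => [w _|//] /=.
by have := valueN (valueZ (rho i * w) (value_zeta_pole_infty w)); rewrite mulr1.
Qed.

(** Subtracting the polar part leaves a function k without finite poles, hence a polynomial. At
    infinity - zeta k has a finite value, the sum of all the residues; this forces k = 0, and then
    the sum is 0. *)
Lemma partial_fractions rho h :
  (forall p, (forall i, S i -> x i <> p) -> regular h p) ->
  (forall i, S i -> value (log_part h (x i)) (x i) (rho i)) ->
  h = polar_part rho /\ \sum_(i | S i) rho i = 0.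
Proof.
move=> reg log.
pose k := h - polar_part rho.
have [q qE] : exists q : {poly C}, k = q%:F.
  apply: entire_polynomial => z.
  have [[i [Si xi]]|noti] := pselect (exists i, S i /\ x i = Some z).
    apply: value_div_zeta_sub; rewrite mulrBr -(subrr (rho i)).
    apply: valueB; [have := log i Si|have := polar_part_finite_log_part rho Si xi];
      by rewrite xi /log_part /= mulr1 mulrC.
  have noti' i : S i -> x i <> Some z by move=> Si xi; apply: noti; exists i.
  have [c hc] := reg (Some z) noti'; rewrite /= mulr1 in hc.
  exists (c - \sum_(i | S i) rho i * (if x i is Some w then (z - w)^-1 else 0)).
  apply: valueB => //; apply: value_sum => i Si; apply: valueZ.
  have := noti' i Si; case: (x i) => [w ne|_]; last exact: value0.
  by apply: value_pole_fin; apply: contra_notN ne => /eqP ->.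
(* r is the residue of h at infinity: [rho i] if some [x i] is infinite, and 0 otherwise, h being
   regular there. *)
have [r hr rE] : exists2 r, value (log_part h None) None r &
    \sum_(i | S i) rho i = \sum_(i | S i && (x i != None)) rho i + r.
  have [[i [Si xi]]|noti] := pselect (exists i, S i /\ x i = None).
    exists (rho i); first by have := log i Si; rewrite xi.
    rewrite (bigD1 i) //= addrC; congr (_ + _).
    apply: eq_bigl => j; case Sj: (S j) => //=; congr negb.
    by rewrite -xi (inj_in_eq x_inj).
  exists 0; first by apply: regular_log_part; apply: reg => i Si xi; apply: noti; exists i.
  rewrite addr0; apply: eq_bigl => i; case Si: (S i) => //=; symmetry.
  by apply/eqP => xi; apply: noti; exists i.
have hk := valueB hr (polar_part_infinite_log_part rho).
rewrite opprK (addrC r) -rE in hk.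
have kE : log_part h None - log_part (polar_part rho) None = - (zt * k).
  by rewrite /log_part /k /=; field; exact: zeta_neq0.
rewrite kE in hk.
(* A nonzero polynomial q would give zeta q a pole at infinity. *)
have q0 : q = 0.
  move: hk => /valueN/valueP; rewrite opprK qE.
  move=> [r' [b [b0 E]]] /= sr; apply: contraPeq E => q0 E.
  have bF : b%:F != 0  by rewrite iota_eq0.
  set d := - _ in E.
  have /eqP : ('X * q * b)%:F = (d *: b + r')%:F.
    apply: (mulIf (invr_neq0 bF)); rewrite [in LHS]rmorphM /= mulfK // [in LHS]rmorphM /= E.
    by rewrite -mul_polyC /const rmorphD rmorphM /=; field.
  rewrite (inj_eq iota_inj) => /eqP/(congr1 (fun p : {poly C} => size p)).
  rewrite -mulrA mulrC size_mulX ?mulf_neq0 // size_mul // => sE.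
  have : (size (d *: b + r')%R <= size b)%N.
    rewrite (leq_trans (size_polyD _ _)) // geq_max size_scale_leq /=; exact: ltnW.
  rewrite -sE; move: q0; rewrite -size_poly_gt0; move: (size q) (size b) => y t; lia.
have k0 : k = 0 by rewrite qE q0 rmorph0.
split; first by apply/eqP; rewrite -subr_eq0 -/k k0.
by move: hk; rewrite k0 mulr0 oppr0 => /value_uniq; apply; apply: value0.
Qed.

Lemma sum_polar_part_mul (n : nat) (d e : 'I_n -> I -> C) :
  \sum_(t < n) polar_part (e t) * polar_part (d t) =
  \sum_(i | S i) \sum_(j | S j) const (\sum_(t < n) d t i * e t j) * (pole (x i) * pole (x j)).
Proof.
rewrite (eq_bigr (fun t => \sum_(i | S i) \sum_(j | S j)
    const (d t i * e t j) * (pole (x i) * pole (x j)))); last first.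
  move=> t _; rewrite mulrC mulr_suml; apply: eq_bigr => i _.
  by rewrite mulr_sumr; apply: eq_bigr => j _; rewrite rmorphM mulrACA.
rewrite exchange_big; apply: eq_bigr => i _; rewrite exchange_big; apply: eq_bigr => j _.
by rewrite rmorph_sum mulr_suml.
Qed.

(** The usual splitting for two finite points; if one point is infinite both sides are 0, since its
    pole is 0 and so is the determinant of (1, 0) with itself. *)
Lemma pole_mul p q : p != q -> pole p * pole q =
  const (cross (1, 0) (hcoord q) / cross (hcoord p) (hcoord q)) * pole p +
  const (cross (1, 0) (hcoord p) / cross (hcoord q) (hcoord p)) * pole q.
Proof.
move=> pq; case: p q pq => [z|] [w|] //= zw;
  rewrite /cross /= ?(mulr0, mul0r, addr0, subr0, mul1r, mulr1, rmorph0) //.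
have zw0 : z - w != 0 by rewrite subr_eq0; apply: contraNneq zw => ->.
have wz0 : w - z != 0 by rewrite -opprB oppr_eq0.
have dE : const (z - w) = const z - const w by rewrite rmorphB.
have cne : const z - const w != 0.
  by rewrite -dE /const iota_eq0 polyC_eq0.
have -> : const (z - w)^-1 = (const z - const w)^-1.
  by apply: (mulfI cne); rewrite mulfV // -dE -rmorphM mulfV // rmorph1.
have -> : const (w - z)^-1 = - (const z - const w)^-1.
  apply: (mulfI cne); rewrite mulrN mulfV // -dE -rmorphM -[z - w]opprB mulNr mulfV //.
  by rewrite rmorphN rmorph1.
by field; rewrite !zeta_sub_neq0 cne.
Qed.

(** The diagonal terms are the double poles. Once they are gone, a sum of simple poles is left,
    which vanishes only if each finite residue does. *)
Lemma polar_product_eq0 (a : I -> I -> C) :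
  \sum_(i | S i) \sum_(j | S j) const (a i j) * (pole (x i) * pole (x j)) = 0 <->
  forall i, S i -> x i <> None ->
    a i i = 0 /\ finite_residue S (fun i j => a i j + a j i) x i = 0.
Proof.
set r := finite_residue _ _ _.
have -> : \sum_(i | S i) \sum_(j | S j) const (a i j) * (pole (x i) * pole (x j)) =
  \sum_(i | S i) const (a i i) * (pole (x i) * pole (x i)) + polar_part r.
  rewrite /polar_part -(@sum_offdiag_split C I S F const a _ _ (fun i j => pole (x i) * pole (x j))).
    by rewrite -big_split; apply: eq_bigr => i Si; rewrite (bigD1 i).
  by move=> i j Si Sj ji; apply: pole_mul; rewrite (inj_in_eq x_inj) // eq_sym.
split=> [Q0|h]; last first.
  rewrite /polar_part -big_split; apply: big1 => i Si /=.
  case xi: (x i) => [z|]; last by rewrite !mulr0 addr0.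
  have [||-> ->] := h i => //; first by rewrite xi.
  by rewrite rmorph0 !mul0r addr0.
(* Multiplying by (zeta - x i)^2 and evaluating at [x i] isolates the coefficient of the double
   pole. *)
have a0 i : S i -> x i <> None -> a i i = 0.
  move=> Si; case xi: (x i) => [z|//] _.
  pose t := zt - const z.
  have vp j : S j -> value (pole (x j) * t) (Some z) ((j == i)%:R).
    move=> Sj; rewrite -(inj_in_eq x_inj) // xi.
    by have := value_log_part_pole z (x j); rewrite log_part_pole_fin.
  have E : (\sum_(i | S i) const (a i i) * (pole (x i) * pole (x i)) + polar_part r) * t ^+ 2 =
     \sum_(i | S i) const (a i i) * ((pole (x i) * t) * (pole (x i) * t)) +
     \sum_(i | S i) const (r i) * (pole (x i) * t) * t.
    rewrite mulrDl !mulr_suml; congr (_ + _); apply: eq_bigr => j _; by ring.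
  have V : value ((\sum_(i | S i) const (a i i) * (pole (x i) * pole (x i)) + polar_part r) * t ^+ 2)
     (Some z) (\sum_(j | S j) a j j * ((j == i)%:R * (j == i)%:R) +
       \sum_(j | S j) r j * (j == i)%:R * 0).
    rewrite E; apply: valueD; apply: value_sum => j Sj.
      by apply/valueZ/valueM; apply: vp.
    apply: valueM; first exact/valueZ/vp.
    by rewrite -(subrr z); apply: value_zeta_sub.
  rewrite Q0 mul0r in V.
  have := value_uniq V (value0 _); rewrite [X in _ + X]big1 ?addr0; last by move=> *; rewrite mulr0.
  rewrite (bigD1 i) //= eqxx !mulr1 big1 ?addr0 //.
  by move=> j /andP[_ /negPf ->]; rewrite !mulr0.
move=> i Si xi; split; first exact: a0.
move: Q0; rewrite big1 ?add0r => [Q0|j Sj]; last first.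
  case xj: (x j) => [w|]; last by rewrite !mulr0.
  by rewrite a0 ?rmorph0 ?mul0r // xj.
case E: (x i) xi => [z|//] _.
have := polar_part_finite_log_part r Si E; rewrite Q0 /log_part !mul0r => V.
exact: value_uniq V (value0 _).
Qed.

End PartialFractions.

(** * Logarithmic derivatives *)

Lemma log_derivative_eq (a b n d : {poly C}) : b != 0 -> n != 0 -> d != 0 ->
  a%:F / b%:F = n%:F / d%:F ->
  (n^`())%:F / n%:F - (d^`())%:F / d%:F = (a^`())%:F / a%:F - (b^`())%:F / b%:F.
Proof.
move=> b0 n0 d0 E.
have bF : b%:F != 0 by rewrite iota_eq0.
have nF : n%:F != 0 by rewrite iota_eq0.
have dF : d%:F != 0 by rewrite iota_eq0.
have E1 : a%:F * d%:F = n%:F * b%:F by apply/eqP; rewrite -eqr_div // E.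
have aF : a%:F != 0.
  by have := mulf_neq0 nF bF; rewrite -E1 mulf_eq0 negb_or => /andP[].
(* The equality of the fractions is differentiated in the form a d = n b. *)
have := congr1 (fun r => (r^`())%:F) (iota_inj (_ : (a * d)%:F = (n * b)%:F)).
rewrite !derivM !rmorphD !rmorphM /= => /(_ E1) E2.
have AE : a%:F = n%:F * b%:F / d%:F by rewrite -E1 mulfK.
have A'E : (a^`())%:F = ((n^`())%:F * b%:F + n%:F * (b^`())%:F - a%:F * (d^`())%:F) / d%:F.
  by rewrite -E2 addrK mulfK.
by rewrite A'E AE; field; rewrite nF bF dF.
Qed.

Variable dl : F -> F.
Hypothesis dl_frac : forall a b : {poly C}, a != 0 -> b != 0 ->
  dl (a%:F / b%:F) = (a^`())%:F / a%:F - (b^`())%:F / b%:F.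

Lemma frac_neq0 g : g != 0 -> exists a b : {poly C}, [/\ a != 0, b != 0 & g = a%:F / b%:F].
Proof.
have [a [b [b0 ->]]] := fracE g => g0; exists a, b; split=> //.
by apply: contraNneq g0 => ->; rewrite rmorph0 mul0r.
Qed.

Lemma dlM g h : g != 0 -> h != 0 -> dl (g * h) = dl g + dl h.
Proof.
move=> /frac_neq0[a [b [a0 b0 ->]]] /frac_neq0[a' [b' [a0' b0' ->]]].
rewrite mulf_div -!rmorphM !dl_frac ?mulf_neq0 // !derivM !rmorphD !rmorphM /=.
by field; rewrite !iota_eq0 a0 b0 a0' b0'.
Qed.

Lemma dl1 : dl (1 : F) = 0.
Proof.
apply: (addrI (dl (1 : F))).
by rewrite -dlM ?oner_neq0 // mulr1 addr0.
Qed.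

Lemma dlX g k : g != 0 -> dl (g ^+ k) = dl g *+ k.
Proof.
move=> g0; elim: k => [|k IH]; first by rewrite expr0 dl1.
by rewrite exprS dlM ?expf_neq0 // IH mulrS.
Qed.

Lemma param_neq0 p : param p != 0.
Proof. by case: p => [z|] /=; rewrite ?zeta_sub_neq0 // invr_neq0 ?zeta_neq0. Qed.

Lemma log_part_dl_param p : log_part (dl (param p)) p = 1.
Proof.
have d1 : (1 : {poly C})^`() = 0 by rewrite -polyC1 derivC.
rewrite /log_part; case: p => [z|] /=.
  have -> : zt - const z = ('X - z%:P)%:F / 1%:F by rewrite rmorph1 divr1 zeta_sub.
  rewrite dl_frac ?oner_neq0 ?polyXsubC_eq0 // d1 rmorph0 mul0r subr0 derivXsubC !rmorph1 !divr1.
  by rewrite mulr1 div1r mulVf // iota_eq0 polyXsubC_eq0.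
have -> : zt^-1 = 1%:F / zt by rewrite rmorph1 div1r.
rewrite dl_frac ?oner_neq0 ?polyX_eq0 // d1 derivX !rmorph1 rmorph0.
by field; rewrite zeta_neq0 oner_neq0.
Qed.

Lemma value_neq0 g p c : value g p c -> c != 0 -> g != 0.
Proof. by move=> h; apply: contraNneq => g0; rewrite g0 in h; rewrite (value_uniq h (value0 p)). Qed.

(** With g = (c b + r) / b the terms in c cancel, and the numerator of d log g is r' b - r b'. At
    infinity deg r < deg b bounds its degree by 2 deg b - 2, which compensates the factor zeta^2
    coming from d zeta. *)
Lemma dl_regular g p c : value g p c -> c != 0 -> regular (dl g) p.
Proof.
move=> h c0; have g0 := value_neq0 h c0.
have [r [b [b0 gE v]]] := (valueP g p c).1 h.
have bF : b%:F != 0  by rewrite iota_eq0.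
pose a := c *: b + r.
have {}gE : g = a%:F / b%:F.
  by rewrite gE /a -mul_polyC /const rmorphD rmorphM /=; field.
have a0 : a != 0 by apply: contraNneq g0 => a0; rewrite gE a0 rmorph0 mul0r.
have aF : a%:F != 0  by rewrite iota_eq0.
have dE : dl g = (r^`() * b - r * b^`())%:F / (a * b)%:F.
  rewrite gE dl_frac // /a derivD derivZ -!mul_polyC !(rmorphB, rmorphD, rmorphM) /=.
  by field; rewrite bF -rmorphM -rmorphD mul_polyC aF.
case: p v h => [z [bz rz]|s] h.
  exists ((r^`() * b - r * b^`()).[z] / (a * b).[z]); rewrite mulr1 dE.
  exists (r^`() * b - r * b^`()), (a * b); rewrite mulf_neq0 //; split=> //; split=> //; split=> //.
  by rewrite hornerM mulf_neq0 // /a hornerD hornerZ rz addr0 mulf_neq0.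
have sa : size a = size b.
  rewrite /a size_polyDl ?size_scale //.
set N := - (r^`() * b - r * b^`()) * 'X ^+ 2.
exists (N`_(size (a * b)).-1 / lead_coef (a * b)); rewrite /=.
exists N, (a * b); rewrite mulf_neq0 //; split=> //; split; last split=> //.
  by rewrite dE /N [iota (_ * 'X^2)]rmorphM rmorphN rmorphXn /= mulrN !mulNr mulrAC.
have [r0|r0] := eqVneq r 0.
  by rewrite /N r0 deriv0 !mul0r subr0 oppr0 mul0r size_poly0.
have sD : (size (r^`() * b - r * b^`())%R <= (size b + size b).-1.-2)%N.
  have := size_polyD (r^`() * b) (- (r * b^`())); rewrite size_polyN.
  have := size_polyMleq r^`() b; have := size_polyMleq r b^`().
  move: s r0 (lt_size_deriv r0) (lt_size_deriv b0); rewrite -size_poly_gt0 /=.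
  set A := r^`() * b; set B := r * b^`().
  move: (size (A - B)%R) (size A) (size B) (size r^`()) (size b^`()) (size r) (size b).
  move=> x1 x2 x3 x4 x5 x6 x7; lia.
rewrite (leq_trans (size_polyMleq _ _)) // size_polyN size_polyXn size_mul // sa.
move: s r0 sD; rewrite -size_poly_gt0 /=.
set D := r^`() * b - r * b^`().
by move: (size D) (size r) (size b) => x1 x2 x3; lia.
Qed.

(** g is the k-th power of the local parameter times a function with nonzero value, whose
    logarithmic derivative is regular. *)
Lemma dl_order g p k c : value (g / param p ^+ k) p c -> c != 0 ->
  value (log_part (dl g) p) p k%:R.
Proof.
move=> h c0; have h0 := value_neq0 h c0.
have t0 : param p ^+ k != 0 by rewrite expf_neq0 ?param_neq0.
have -> : g = g / param p ^+ k * param p ^+ k by rewrite divfK.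
rewrite dlM // dlX ?param_neq0 // log_partD -[k%:R]add0r; apply: valueD.
  exact/regular_log_part/(dl_regular h).
have -> : log_part (dl (param p) *+ k) p = log_part (dl (param p)) p *+ k.
  by rewrite /log_part !mulrnAl.
by rewrite log_part_dl_param -(rmorph_nat const); apply: value_const.
Qed.

End RationalFunctions.

(** * Transfer to the function field of the projective line *)

Section ProjectiveLineForms.
Variable C : numClosedFieldType.
Implicit Types (g h : ratfun C) (p : P1 C) (c : C).
Local Notation tf := (@FracField.tofrac {poly C}).
Local Notation "x %:F" := (tf x) : ring_scope.

Lemma tofrac_inj : injective tf.
Proof. by move=> a b /eqP; rewrite tofrac_eq => /eqP. Qed.

Lemma ratfunE g : g = (\n_(repr g))%:F / (\d_(repr g))%:F.
Proof.
rewrite -[LHS]reprK -[in LHS](Ratio_numden (repr g)).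
have d0 := denom_ratioP (repr g).
have d0' : (\d_(repr g))%:F != 0 :> ratfun C by rewrite tofrac_eq0.
apply: (mulIf d0'); rewrite mulfVK //; unlock FracField.tofrac.
rewrite -[LHS]FracField.pi_mul.
apply/eqmodP => /=; rewrite equivfE /FracField.mulf.
have d1 := mulf_neq0 d0 (oner_neq0 _).
rewrite !(numer_Ratio _ (oner_neq0 _), denom_Ratio _ (oner_neq0 _), numer_Ratio _ d0, denom_Ratio _ d0).
by rewrite (numer_Ratio _ d1) (denom_Ratio _ d1) !mulr1 mulrC eqxx.
Qed.

Lemma ratfun_fracE g : exists a b : {poly C}, b != 0 /\ g = a%:F / b%:F.
Proof. by exists (\n_(repr g)), (\d_(repr g)); split; [exact: denom_ratioP|exact: ratfunE]. Qed.

(** [dlog] is computed from a chosen representative of the fraction; any other one gives the same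
    result. *)
Lemma dlog_frac (a b : {poly C}) : a != 0 -> b != 0 ->
  dlog (a%:F / b%:F) = (a^`())%:F / a%:F - (b^`())%:F / b%:F.
Proof.
move=> a0 b0; rewrite /dlog; move: (ratfunE (a%:F / b%:F)) (denom_ratioP (repr (a%:F / b%:F))).
cbv zeta; move: \n_(repr _) \d_(repr _) => n d E d0.
apply: (log_derivative_eq tofrac_inj) => //.
have : a%:F / b%:F != 0 :> ratfun C by rewrite mulf_neq0 // ?invr_eq0 tofrac_eq0.
by rewrite E; apply: contraNneq => ->; rewrite tofrac0 mul0r.
Qed.

Lemma log_coefE g p : log_coef g p = log_part tf g p.
Proof. by []. Qed.
Lemma regular_formE g p : regular_form g p = regular tf g p.
Proof. by []. Qed.
Lemma has_valueE g p c : has_value g p c = value tf g p c.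
Proof. by []. Qed.

Lemma has_value_uniq g p c (d : C) : has_value g p c -> has_value g p d -> c = d.
Proof. exact: (value_uniq tofrac_inj). Qed.

Lemma has_valueM g h p c (d : C) : has_value g p c -> has_value h p d ->
  has_value (g * h) p (c * d).
Proof. exact: (valueM tofrac_inj). Qed.

Lemma has_valueB g h p c (d : C) : has_value g p c -> has_value h p d ->
  has_value (g - h) p (c - d).
Proof. exact: (valueB tofrac_inj). Qed.

Lemma residue_eq g p c : has_value (log_coef g p) p c -> residue g p = c.
Proof.
move=> h; apply: (has_value_uniq (_ : has_value (log_coef g p) p _) h).
by rewrite /residue; case: xgetP => [d _ //|/(_ c)/(_ h)].
Qed.

Lemma residueP g p : log_form g p -> has_value (log_coef g p) p (residue g p).
Proof. by move=> [c h]; rewrite (residue_eq h). Qed.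

Lemma regular_residue g p : regular_form g p -> has_value (log_coef g p) p 0.
Proof. by rewrite regular_formE log_coefE has_valueE; apply: regular_log_part tofrac_inj _ _. Qed.

(** Multiplying b by the linear factors of the finitely many excluded points gives a nonzero
    polynomial, any non-root of which will do. *)
Lemma cofinite_generic_point (A : set (P1 C)) (b : {poly C}) :
  finite_set (~` A)%classic -> b != 0 -> exists2 z, A (Some z) & b.[z] != 0.
Proof.
move=> /finite_seqP[s sE] b0.
have q0 : b * \prod_(x <- s) (if x is Some z then 'X - z%:P else 1) != 0.
  rewrite mulf_neq0 // prodf_seq_neq0; apply/allP => -[z|] _ //=; last by rewrite oner_eq0.
  by rewrite polyXsubC_eq0.
have [z] := closed_nonrootP _ q0; rewrite /root hornerM mulf_eq0 negb_or => /andP[bz sz].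
exists z => //; apply: contrapT => nA.
have : (~` A)%classic (Some z) by [].
rewrite sE /= => zs; move: sz; rewrite horner_prod prodf_seq_neq0 => /allP/(_ _ zs) /=.
by rewrite hornerXsubC subrr eqxx.
Qed.

Lemma zariski_open_cofinite (A : set (P1 C)) :
  zariski_open A -> (A !=set0)%classic -> finite_set (~` A)%classic.
Proof. by move=> [->|//] [p []]. Qed.

(** A nonzero numerator of g - h would have a non-root in A, where the two values agree. *)
Lemma ratfun_eq (A : set (P1 C)) (F : P1 C -> C) g h :
  zariski_open A -> (A !=set0)%classic -> agrees_on A F g -> agrees_on A F h -> g = h.
Proof.
move=> oA nA hg hh; apply/eqP; rewrite -subr_eq0.
have [a [b [b0 E]]] := ratfun_fracE (g - h).
rewrite E mulf_eq0 tofrac_eq0; apply: contraT; rewrite negb_or => /andP[a0 _].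
have [z Az az] := cofinite_generic_point (zariski_open_cofinite oA nA) a0.
have V : has_value (g - h) (Some z) (F (Some z) - F (Some z)).
  exact: has_valueB (hg _ Az) (hh _ Az).
rewrite subrr E in V; have := value_frac tofrac_inj b0 V.
by rewrite mul0r => /eqP; rewrite (negPf az).
Qed.

Lemma zariski_openI (A B : set (P1 C)) : zariski_open A -> zariski_open B ->
  (A !=set0)%classic -> (B !=set0)%classic ->
  zariski_open (A `&` B)%classic /\ (A `&` B !=set0)%classic.
Proof.
move=> oA oB nA nB.
have fAB : finite_set (~` (A `&` B)%classic).
  by rewrite setCI finite_setU; split; apply: zariski_open_cofinite.
split; first by right.
by have [z ? _] := cofinite_generic_point fAB (oner_neq0 _); exists (Some z).
Qed.

Lemma ratfun_constD c (d : C) : ratfun_const (c + d) = ratfun_const c + ratfun_const d.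
Proof. by rewrite /ratfun_const polyCD tofracD. Qed.

Lemma ratfun_constM c (d : C) : ratfun_const (c * d) = ratfun_const c * ratfun_const d.
Proof. by rewrite /ratfun_const polyCM tofracM. Qed.

Lemma dlogM g h : g != 0 -> h != 0 -> dlog (g * h) = dlog g + dlog h.
Proof. exact: (@dlM C (ratfun C) tf tofrac_inj ratfun_fracE (@dlog C) dlog_frac). Qed.

Lemma dlog_regular g p c : has_value g p c -> c != 0 -> regular_form (dlog g) p.
Proof.
rewrite has_valueE regular_formE.
exact: (@dl_regular C (ratfun C) tf tofrac_inj (@dlog C) dlog_frac).
Qed.

Lemma dlog_order g p k c : has_value (g / local_param p ^+ k) p c -> c != 0 ->
  has_value (log_coef (dlog g) p) p k%:R.
Proof.
rewrite log_coefE !has_valueE.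
exact: (@dl_order C (ratfun C) tf tofrac_inj ratfun_fracE (@dlog C) dlog_frac).
Qed.

Lemma has_value_log_coefB g h p c (d : C) : has_value (log_coef g p) p c ->
  has_value (log_coef h p) p d -> has_value (log_coef (g - h) p) p (c - d).
Proof. rewrite !log_coefE !has_valueE; exact: (value_log_partB tofrac_inj). Qed.

Lemma has_value_log_coefMz g p c (k : int) : has_value (log_coef g p) p c ->
  has_value (log_coef (g *~ k) p) p (c *~ k).
Proof. rewrite !log_coefE !has_valueE; exact: (value_log_partMz tofrac_inj). Qed.

Lemma has_value_neq0 g p c : has_value g p c -> c != 0 -> g != 0.
Proof. exact: (@value_neq0 C (ratfun C) tf tofrac_inj). Qed.

(** * Forms with prescribed residues *)

Section Poles.
Variables (I : finType) (S : pred I) (x : I -> P1 C).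
Hypothesis x_inj : {in S &, injective x}.

Definition form_with_residues (rho : I -> C) : ratfun C := polar_part tf S x rho.

Lemma form_with_residuesE rho : form_with_residues rho =
  \sum_(i | S i) ratfun_const (rho i) * pole tf (x i).
Proof. by []. Qed.

Lemma form_partial_fractions (rho : I -> C) h :
  (forall p, (forall i, S i -> x i <> p) -> regular_form h p) ->
  (forall i, S i -> has_value (log_coef h (x i)) (x i) (rho i)) ->
  h = form_with_residues rho /\ \sum_(i | S i) rho i = 0.
Proof.
move=> reg log; apply: (@partial_fractions C (ratfun C) tf tofrac_inj ratfun_fracE I S x x_inj).
  by move=> p hp; rewrite -regular_formE; apply: reg.
by move=> i Si; rewrite -log_coefE -has_valueE; apply: log.
Qed.

Lemma form_with_residues_log_coef (rho : I -> C) i : \sum_(i | S i) rho i = 0 -> S i ->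
  has_value (log_coef (form_with_residues rho) (x i)) (x i) (rho i).
Proof.
move=> s0 Si; rewrite log_coefE has_valueE.
exact: (@polar_part_log_part C (ratfun C) tf tofrac_inj I S x x_inj).
Qed.

Lemma form_with_residues_regular (rho : I -> C) p : \sum_(i | S i) rho i = 0 ->
  (forall i, S i -> x i <> p) -> regular_form (form_with_residues rho) p.
Proof.
by rewrite regular_formE => s0 h; apply: (@polar_part_regular C (ratfun C) tf tofrac_inj I S x).
Qed.

(** Meant for [d] the residues of d log of the basis monomials and [e] those of the coordinates of a
    section; the sum over t is then the pairing of N^vee with N. *)
Lemma contraction_eq0 (n : nat) (d e : 'I_n -> I -> C) :
  \sum_(t < n) form_with_residues (e t) * form_with_residues (d t) = 0 <->
  forall i, S i -> x i <> None ->
    \sum_(t < n) d t i * e t i = 0 /\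
    finite_residue S
      (fun i j => \sum_(t < n) d t i * e t j + \sum_(t < n) d t j * e t i) x i = 0.
Proof.
rewrite (@sum_polar_part_mul C (ratfun C) tf I S x).
exact: (@polar_product_eq0 C (ratfun C) tf tofrac_inj I S x x_inj).
Qed.

End Poles.
End ProjectiveLineForms.

(** * Monomials on a component *)

Lemma primitive_pairing1 (n : nat) (u : 'cV[int]_n) : primitive u ->
  exists m : 'rV[int]_n, (m *m u) 0 0 = 1.
Proof.
move=> up.
(* Coordinate by coordinate, Bezout's identity makes <m, u> a divisor of all the coordinates of u;
   by primitivity it is then 1 or -1. *)
have [m hm] : exists m : 'rV[int]_n, forall i, i \in enum 'I_n -> u i 0 \in dvdz ((m *m u) 0 0).
  elim: (enum _) => [|i s [m IH]]; first by exists 0.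
  have [a [b E]] := Bezoutz ((m *m u) 0 0) (u i 0).
  exists (a *: m + b *: delta_mx 0 i).
  have -> : ((a *: m + b *: delta_mx 0 i) *m u) 0 0 = gcdz ((m *m u) 0 0) (u i 0).
    by rewrite -E mulmxDl -!scalemxAl -rowE !mxE.
  move=> j; rewrite inE => /orP[/eqP ->|/IH h]; first exact: dvdz_gcdr.
  by apply: dvdz_trans h; apply: dvdz_gcdl.
pose d : int := (m *m u) 0 0.
have d1 : `|d| = 1.
  apply: (up d (\col_i divz (u i 0) d)); apply/colP => i; rewrite [RHS]mxE mxE mulrC divzK //.
  by apply: hm; rewrite mem_enum.
exists (d *: m); rewrite -scalemxAl mxE -/d.
have: `|d| * `|d| = 1 by rewrite d1.
by rewrite -normrM ger0_norm // -expr2 sqr_ge0.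
Qed.

Section Pullback.
Variables (R : realType) (n : nat) (T : tropical n).
Variables (P : set (set 'cV[R]_n)) (phi : nodal_map R T).
Hypotheses (phi_prelog : prelog_curve P phi) (phi_type : of_type P phi).
Hypothesis dir_primitive : forall f : flag T, primitive (dir (fe f) (fs f)).
Variable V : vertex T.
Local Notation C := R[i].
Local Notation x_ := (flag_point phi).
Local Notation v := (posR R V).
Local Notation F := (component phi V).
Local Open Scope classical_set_scope.

Definition torus_locus : set (P1 C) := [set p | in_big_torus P v (F p)].

Lemma torus_locusPn p : ~ torus_locus p <-> exists2 f : flag T, fv f = V & x_ f = p.
Proof. by have [_ /(_ V p) h _] := phi_type. Qed.

Lemma torus_locus_cofinite : finite_set (~` torus_locus).
Proof.
apply: (@sub_finite_set _ _ [set` [seq x_ f | f <- enum {: flag T}]]); last exact: finite_seq.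
move=> p /torus_locusPn[f _ <-] /=; apply: map_f; exact: mem_enum.
Qed.

Lemma torus_locus_open : zariski_open torus_locus.
Proof. by right; apply: torus_locus_cofinite. Qed.

Lemma torus_locus_nonempty : torus_locus !=set0.
Proof.
by have [z ? _] := cofinite_generic_point torus_locus_cofinite (oner_neq0 _); exists (Some z).
Qed.

(** Nonempty open subsets of the line meet, so all the local expressions of a regular function are
    one and the same rational function. *)
Lemma monomial_agrees (m : 'rV[int]_n) :
  exists g, agrees_on torus_locus (fun p => (F p).2 m) g.
Proof.
have [_ _ /(_ V)[inV chart] _ _] := phi_prelog.
have [p0 Tp0] := torus_locus_nonempty.
have [[[p0P _ _] _] p0E] := Tp0; rewrite p0E in p0P.
have [_ /(_ m)] := chart [set v] p0P erefl.
(* The chart of the cell reduced to v is the big torus, on which every monomial is regular. *)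
have -> : [set p | in_chart P v [set v] (F p)] = torus_locus.
  apply/seteqP; split=> p /= [pv pE]; split=> //.
    by apply/seteqP; split=> // y ->; case: pv.
  by rewrite pE.
move=> reg'; have reg : regular_on torus_locus (fun p => (F p).2 m) by apply: reg' => y ->.
have [B0 [g0 [oB0 B0p0 h0]]] := reg _ Tp0.
exists g0 => p Tp; have [B [g [oB Bp h]]] := reg _ Tp.
suff <- : g = g0 by apply: h.
have nT := torus_locus_nonempty; have oT := torus_locus_open.
have [oTB nTB] := zariski_openI oT oB nT (ex_intro _ _ Bp).
have [oTBB nTBB] := zariski_openI oTB oB0 nTB (ex_intro _ _ B0p0).
apply: (ratfun_eq (F := fun p => (F p).2 m) oTBB nTBB) => q [[? ?] ?]; first by apply: h.
by apply: h0.
Qed.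

(** [pullback] chooses some rational function agreeing with the monomial on a nonempty open set; as
    such sets meet the torus locus, the choice is unique. *)
Lemma pullback_agrees (m : 'rV[int]_n) :
  agrees_on torus_locus (fun p => (F p).2 m) (pullback F m).
Proof.
have [g hg] := monomial_agrees m.
rewrite /pullback; case: xgetP => [h _ [A [oA nA hA]]|/(_ g)[]]; last first.
  exists torus_locus; split=> //; [exact: torus_locus_open|exact: torus_locus_nonempty].
have [o ne] := zariski_openI oA torus_locus_open nA torus_locus_nonempty.
suff -> : h = g by [].
by apply: (ratfun_eq (F := fun p => (F p).2 m) o ne) => q [? ?]; [apply: hA|apply: hg].
Qed.

Lemma pullback_unique (m : 'rV[int]_n) A g : zariski_open A -> A !=set0 ->
  agrees_on A (fun p => (F p).2 m) g -> pullback F m = g.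
Proof.
move=> oA nA hA.
have [o ne] := zariski_openI oA torus_locus_open nA torus_locus_nonempty.
by apply: (ratfun_eq (F := fun p => (F p).2 m) o ne) => q [? ?]; [apply: pullback_agrees|apply: hA].
Qed.

Lemma monomial_neq0 (m : 'rV[int]_n) p : torus_locus p -> (F p).2 m != 0.
Proof.
by move=> [[[_ /(_ m) h _] _] pE]; apply/h; rewrite pE => y z -> ->.
Qed.

Lemma pullback_neq0 m : pullback F m != 0.
Proof.
have [p Tp] := torus_locus_nonempty.
exact: has_value_neq0 (pullback_agrees m Tp) (monomial_neq0 _ Tp).
Qed.

Lemma pullbackD m m' : pullback F (m + m') = pullback F m * pullback F m'.
Proof.
apply: (pullback_unique torus_locus_open torus_locus_nonempty) => p Tp.
have [[[_ _ mulF] _] pE] := Tp.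
have cst (k : 'rV[int]_n) : constant_on (F p).1 k by rewrite pE => y z -> ->.
by rewrite mulF //; apply: has_valueM; apply: pullback_agrees.
Qed.

Definition dlog_monomial (m : 'rV[int]_n) := dlog (pullback F m).

Lemma dlog_monomial_is_additive : zmod_morphism dlog_monomial.
Proof.
move=> m m'; apply/eqP; rewrite eq_sym subr_eq /dlog_monomial.
by rewrite -dlogM ?pullback_neq0 // -pullbackD subrK.
Qed.
HB.instance Definition _ := GRing.isZmodMorphism.Build 'rV[int]_n (ratfun C) dlog_monomial
  dlog_monomial_is_additive.

Lemma dlog_monomial_regular m p : (forall f : flag T, fv f = V -> x_ f <> p) ->
  regular_form (dlog_monomial m) p.
Proof.
move=> h; have Tp : torus_locus p.
  by apply: contrapT => /torus_locusPn[f fV]; apply: h.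
exact: dlog_regular (pullback_agrees m Tp) (monomial_neq0 _ Tp).
Qed.

Lemma dlog_monomial_order1 m (f : flag T) : fv f = V ->
  (m *m dir (fe f) (fs f)) 0 0 = 1 ->
  has_value (log_coef (dlog_monomial m) (x_ f)) (x_ f) (weight (fe f))%:R.
Proof.
move=> fV m1; have [_ _ /(_ f)[_ /(_ m m1)]] := phi_type.
rewrite fV => -[A [g [oA Ap hA [c c0 h]]]].
rewrite /dlog_monomial (pullback_unique oA (ex_intro _ _ Ap) hA).
exact: dlog_order h c0.
Qed.

Lemma dlog_monomial_residue m (f : flag T) : fv f = V ->
  has_value (log_coef (dlog_monomial m) (x_ f)) (x_ f)
    ((weight (fe f))%:R * ((m *m dir (fe f) (fs f)) 0 0)%:~R).
Proof.
move=> fV; have [m0 m01] := primitive_pairing1 (@dir_primitive f).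
set k := (m *m _) 0 0; set u := dir _ _ in m01 k *.
have m1 : ((m + (1 - k) *: m0) *m u) 0 0 = 1.
  by rewrite mulmxDl -scalemxAl mxE [X in _ + X]mxE m01 -/k mulr1 addrC subrK.
(* m is the difference of a character that pairs to 1 with the direction and a multiple of another
   such character. *)
have E : dlog_monomial m = dlog_monomial (m + (1 - k) *: m0) - dlog_monomial m0 *~ (1 - k).
  rewrite -raddfMz -raddfB -scaler_int intz addrK //.
rewrite E; have -> : (weight (fe f))%:R * k%:~R = (weight (fe f))%:R - (weight (fe f))%:R *~ (1 - k) :> C.
  by rewrite -[_ *~ (1 - k)]mulrzr rmorphB /= mulrBr mulr1 opprB addrC subrK.
apply: has_value_log_coefB; first exact: dlog_monomial_order1.
by apply: has_value_log_coefMz; apply: dlog_monomial_order1.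
Qed.

(** The second half is the residue theorem for d log of the monomial, that is, the balancing
    condition at V paired with m. *)
Lemma dlog_pullback (m : 'rV[int]_n) :
  {in [pred f | fv f == V] &, injective x_} ->
  dlog (pullback F m) = form_with_residues [pred f | fv f == V] x_
    (fun f => (weight (fe f))%:R * ((m *m dir (fe f) (fs f)) 0 0)%:~R) /\
  \sum_(f : flag T | fv f == V) (weight (fe f))%:R * ((m *m dir (fe f) (fs f)) 0 0)%:~R = 0 :> C.
Proof.
move=> x_inj; apply: (form_partial_fractions x_inj (h := dlog_monomial m)) => [p h|f /eqP fV].
  by apply: dlog_monomial_regular => f fV; apply: h; apply/eqP.
exact: dlog_monomial_residue.
Qed.

End Pullback.

(** * Graphs *)

(** The only links of [e2] that are new join a and b. Outside the component of a, distinct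
    components of [e1] therefore stay distinct under [e2], and at most one component is lost. *)
Lemma n_comp_add_edge (V : finType) (e1 e2 : rel V) (a b : V) :
  connect_sym e1 -> connect_sym e2 ->
  (forall x y, e2 x y -> e1 x y \/ (x \in [:: a; b] /\ y \in [:: a; b])) ->
  (n_comp e1 [set: V] <= (n_comp e2 [set: V]).+1)%N.
Proof.
move=> s1 s2 e21.
pose ab x := connect e1 a x || connect e1 b x.
have abS x y : connect e1 x y -> ab x -> ab y.
  by move=> xy /orP[] h; apply/orP; [left|right]; apply: connect_trans h xy.
(* A path of [e2] stays in one component of [e1], unless both its ends lie in the components of a
   and b. *)
have e2c x y : connect e2 x y -> connect e1 x y || (ab x && ab y).
  move=> /connectP[p]; elim: p x => [|z p IH] x /=; first by move=> _ ->; rewrite connect0.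
  move=> /andP[xz zp] yE; have := IH z zp yE => /orP zy.
  case: (e21 _ _ xz) => [/connect1 xz'|[xab zab]].
    case: zy => [zy|/andP[az ay]]; first by rewrite (connect_trans xz' zy).
    by rewrite ay (abS z) ?orbT // s1.
  have ab_ w : w \in [:: a; b] -> ab w.
    by rewrite !inE /ab => /orP[] /eqP ->; rewrite connect0 ?orbT.
  rewrite (ab_ _ xab); case: zy => [zy|/andP[_ ->]]; last by rewrite orbT.
  by rewrite (abS _ _ zy (ab_ _ zab)) orbT.
pose A := [set x | roots e1 x & ~~ connect e1 a x].
have A_inj : {in A &, injective (fingraph.root e2)}.
  move=> x y; rewrite !inE => /andP[rx nx] /andP[ry ny] /eqP.
  rewrite root_connect // => /e2c; rewrite /ab (negPf nx) (negPf ny) /= => xy.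
  have : connect e1 x y.
    by case/orP: xy => // /andP[bx by_]; apply: connect_trans by_; rewrite s1.
  by move/(fingraph.rootP s1); rewrite (eqP rx) (eqP ry).
have nE e : n_comp e [set: V] = #|[set x | roots e x]|.
  by apply: eq_card => x; rewrite !inE andbT.
rewrite !nE; have sub : (#|A| <= #|[set x | roots e2 x]|)%N.
  rewrite -(card_in_imset A_inj); apply: subset_leq_card; apply/fintype.subsetP => y /imsetP[x _ ->].
  by rewrite inE roots_root.
apply: leq_trans (_ : #|fingraph.root e1 a |: A| <= _)%N; last first.
  by rewrite cardsU1; apply: leq_trans (_ : 1 + #|A| <= _)%N; rewrite ?leq_add2r ?leq_b1 // add1n ltnS.
apply: subset_leq_card; apply/fintype.subsetP => x; rewrite !inE => rx.
have [ax|] := boolP (connect e1 a x); last by rewrite rx orbT.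
by rewrite (fingraph.rootP s1 ax) (eqP rx) eqxx.
Qed.

Section GraphTheory.
Variable G : wgraph.
Implicit Types (S : {set edge G}) (e : edge G).

Lemma adjacent_sym S : symmetric (adjacent S).
Proof.
suff h x y : adjacent S x y -> adjacent S y x by move=> x y; apply/idP/idP; apply: h.
move=> /existsP[e /andP[eS /existsP[b /andP[ex ey]]]].
by apply/existsP; exists e; rewrite eS; apply/existsP; exists (~~ b); rewrite negbK ey.
Qed.

Lemma adjacent_connect_sym S : connect_sym (adjacent S).
Proof. exact/sym_connect_sym/adjacent_sym. Qed.

Lemma adjacentD1 S e : ~~ bounded e -> adjacent (S :\ e) =2 adjacent S.
Proof.
move=> nb x y; apply/existsP/existsP => -[e' /andP[e'S h]]; exists e'; rewrite h andbT.
  by case/setD1P: e'S.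
rewrite in_setD1 e'S andbT; apply: contraNneq nb => <-; rewrite /bounded.
by case/existsP: h => -[] /andP[/eqP-> /eqP->].
Qed.

Lemma components_le S e : (components (S :\ e) <= components S + bounded e)%N.
Proof.
have [bd|nb] := boolP (bounded e); last first.
  rewrite addn0 /components; apply: eq_leq.
  by apply: eq_n_comp; apply: eq_connect; apply: adjacentD1.
move: bd; rewrite /bounded; case Ea: (endpt e false) => [a|//]; case Eb: (endpt e true) => [b|//] _.
rewrite addn1; apply: (@n_comp_add_edge _ _ _ a b); try exact: adjacent_connect_sym.
move=> x y /existsP[e' /andP[e'S h]]; have [E|ne] := eqVneq e' e; last first.
  by left; apply/existsP; exists e'; rewrite in_setD1 ne e'S.
right; move: h; rewrite E => /existsP[[]]; rewrite /= Ea Eb => /andP[/eqP[<-] /eqP[<-]].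
  by rewrite !inE !eqxx orbT.
by rewrite !inE !eqxx orbT.
Qed.

Lemma card_bounded_setD1 S e : e \in S ->
  #|[set e' in S | bounded e']| = (bounded e + #|[set e' in S :\ e | bounded e']|)%N.
Proof.
move=> eS; rewrite (cardsD1 e) inE eS; congr (_ + _)%N; apply: eq_card => e'.
by rewrite !inE andbA.
Qed.

(* Shows that the subtraction in betti1 does not truncate. *)
Lemma euler_bound S : (#|vertex G| <= #|[set e in S | bounded e]| + components S)%N.
Proof.
elim: {S}_.+1 {-2}S (ltnSn #|S|) => // k IH S.
have [->|[e eS]] := set_0Vmem S; last first.
  rewrite (cardsD1 e) eS add1n ltnS => /IH h.
  rewrite (card_bounded_setD1 eS) (leq_trans h) //.
  have := components_le S e; lia.
move=> _; rewrite (leq_trans _ (leq_addl _ _)) // /components -cardsT.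
apply: eq_leq; apply: eq_card => v; rewrite !inE andbT; symmetry.
apply/eqP; symmetry.
have /connectP[p] := connect_root (adjacent (@finset.set0 (edge G))) v.
case: p => [_ ->//|w p /= /andP[/existsP[e]]]; by rewrite inE.
Qed.

Lemma loop_part_bounded e : e \in loop_part G -> bounded e.
Proof.
rewrite inE; apply: contraTT => nb; rewrite -leqNgt /betti1.
rewrite [in X in (X <= _)%N](card_bounded_setD1 (finset.in_setT e)) (negPf nb) add0n.
apply: eq_leq; congr (_ + _ - _)%N; symmetry.
by apply: eq_n_comp; apply: eq_connect; apply: adjacentD1.
Qed.

(** Otherwise removing e would keep the number of components and lower the first Betti number;
    [euler_bound] excludes a truncated subtraction. *)
Lemma bridge_disconnects e v w : e \notin loop_part G ->
  endpt e false = Some v -> endpt e true = Some w ->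
  ~~ connect (adjacent ([set: edge G] :\ e)) v w.
Proof.
move=> + ev ew; apply: contraNN => vw; rewrite inE.
have bd : bounded e by rewrite /bounded ev ew.
have cE : components [set: edge G] = components ([set: edge G] :\ e).
  apply: eq_n_comp => x y; apply/idP/idP; last first.
    apply: connect_sub => {}x {}y /existsP[e' /andP[_ h]]; apply: connect1.
    by apply/existsP; exists e'; rewrite inE.
  apply: connect_sub => {}x {}y /existsP[e' /andP[_ h]].
  have [E|ne] := eqVneq e' e; last first.
    by apply: connect1; apply/existsP; exists e'; rewrite !inE ne.
  move: h; rewrite E => /existsP[[]]; rewrite /= ev ew => /andP[/eqP[<-] /eqP[<-]] //.
  by rewrite adjacent_connect_sym.
have := euler_bound ([set: edge G] :\ e).
rewrite /betti1 cE (card_bounded_setD1 (finset.in_setT e)) bd; lia.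
Qed.

(* Equal to f itself when the edge of f is unbounded. *)
Definition opposite_flag (f : flag G) : flag G :=
  insubd f (odflt (fv f) (endpt (fe f) (~~ fs f)), fe f, ~~ fs f).

Lemma flag_endpt (f : flag G) : endpt (fe f) (fs f) = Some (fv f).
Proof. exact/eqP/(valP f). Qed.

Lemma flag_eqP (f g : flag G) : fe f = fe g -> fs f = fs g -> f = g.
Proof.
move=> ee es; have vv : fv f = fv g.
  by apply: Some_inj; rewrite -!flag_endpt ee es.
apply: val_inj; move: ee es vv; rewrite /fe /fs /fv.
by case: (val f) (val g) => [[? ?] ?] [[? ?] ?] /= -> -> ->.
Qed.

Lemma bounded_endpt (f : flag G) : bounded (fe f) = (endpt (fe f) (~~ fs f) : bool).
Proof. by rewrite /bounded; have := flag_endpt f; case: (fs f) => /= ->; rewrite ?andbT. Qed.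

Lemma flag_exists e b w : endpt e b = Some w -> exists f : flag G, [/\ fv f = w, fe f = e & fs f = b].
Proof.
move=> E; have p : endpt (w, e, b).1.2 (w, e, b).2 == Some (w, e, b).1.1 by rewrite /= E.
by exists (exist _ (w, e, b) p).
Qed.

Lemma opposite_flagP (f : flag G) : bounded (fe f) -> opposite f (opposite_flag f).
Proof.
rewrite bounded_endpt; case E: (endpt _ _) => [w|//] _.
have p : endpt (fe f) (~~ fs f) == Some w by rewrite E.
rewrite /opposite /opposite_flag E /=.
have := @insubdK _ _ (flag G) f (w, fe f, ~~ fs f) p; rewrite /fe /fs => ->.
by rewrite /= eqxx /=; case: (_.2).
Qed.

Lemma opposite_flag_unbounded (f : flag G) : ~~ bounded (fe f) -> opposite_flag f = f.
Proof.
rewrite bounded_endpt; case E: (endpt _ _) => [//|] _.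
rewrite /opposite_flag E /= /insubd insubF //=.
by rewrite E.
Qed.

Lemma opposite_sym (f g : flag G) : opposite f g = opposite g f.
Proof. by rewrite /opposite eq_sym [fs f == _]eq_sym. Qed.

Lemma opposite_bounded (f g : flag G) : opposite f g -> bounded (fe f).
Proof.
move=> /andP[/eqP E s]; rewrite bounded_endpt.
have -> : ~~ fs f = fs g by case: (fs f) (fs g) s => [] [].
by rewrite E flag_endpt.
Qed.

Lemma opposite_inj (f g h : flag G) : opposite f g -> opposite f h -> g = h.
Proof.
move=> /andP[/eqP E s] /andP[/eqP E' s']; apply: flag_eqP; first by rewrite -E.
by case: (fs f) (fs g) (fs h) s s' => [] [] [].
Qed.

Lemma opposite_flagK : involutive opposite_flag.
Proof.
move=> f; have [bd|nb] := boolP (bounded (fe f)); last by rewrite !opposite_flag_unbounded.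
have o := opposite_flagP bd; rewrite opposite_sym in o.
have bd' := opposite_bounded o.
exact/(opposite_inj (opposite_flagP bd') o).
Qed.

Lemma same_edge_flags (f g : flag G) : fe f = fe g -> f = g \/ opposite f g.
Proof.
move=> E; have [s|s] := eqVneq (fs f) (fs g); first by left; apply: flag_eqP.
by right; rewrite /opposite E eqxx.
Qed.

End GraphTheory.

(** * Residues of the elements of H *)

(** For three indices the row sums read b_ij + b_ik = b_ij + b_jk = b_ik + b_jk = 0, whence 2 b_ij =
    0; for two indices b_ij is itself a row sum. *)
Lemma sym_zero_rows_le3 (C : numDomainType) (I : finType) (S : pred I) (b : I -> I -> C) :
  (#|S| <= 3)%N -> (forall i j, b i j = b j i) -> (forall i, S i -> b i i = 0) ->
  (forall i, S i -> \sum_(j | S j) b i j = 0) -> forall i j, S i -> S j -> b i j = 0.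
Proof.
move=> S3 sym b0 s0 i j Si Sj; have [->|ij] := eqVneq i j; first exact: b0.
have sumE k l : S k -> S l -> k != l ->
    b k l + \sum_(m | (S m && (m != k)) && (m != l)) b k m = 0.
  by move=> Sk Sl kl; have := s0 k Sk; rewrite (bigD1 k) //= b0 // add0r (bigD1 l) // Sl eq_sym.
have si := sumE i j Si Sj ij.
case: (pickP [pred k | (S k && (k != i)) && (k != j)]) => [k /= /andP[/andP[Sk ki] kj]|none]; last first.
  by move: si; rewrite big_pred0 ?addr0.
have only m : S m -> m != i -> m != j -> m = k.
  move=> Sm mi mj; apply/eqP; apply: contraTT S3 => mk; rewrite -ltnNge.
  have u : uniq [:: i; j; k; m].
    rewrite /= !inE !negb_or ij (eq_sym i) ki (eq_sym i) mi (eq_sym j) kj (eq_sym j) mj.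
    by rewrite eq_sym mk.
  apply: leq_trans (_ : #|[:: i; j; k; m]| <= _)%N; first by rewrite (card_uniqP u).
  apply: subset_leq_card; apply/fintype.subsetP => l; rewrite !inE.
  by case/or4P => /eqP ->.
have one x y z : [:: x; y; z] =i [:: i; j; k] -> uniq [:: x; y; z] -> b x y + b x z = 0.
  move=> E u; have mem w : w \in [:: x; y; z] -> S w.
    by rewrite E !inE => /or3P[] /eqP ->.
  have [Sx Sy Sz] : [/\ S x, S y & S z] by split; apply: mem; rewrite !inE eqxx ?orbT.
  move: u; rewrite /= !inE !negb_or andbT => /andP[/andP[xy xz] yz].
  rewrite -[RHS](sumE x y Sx Sy xy); congr (_ + _).
  rewrite (big_pred1 z) // => m /=; apply/idP/eqP => [/andP[/andP[Sm mx] my]|->]; last first.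
    by rewrite Sz eq_sym xz eq_sym yz.
  have : m \in [:: i; j; k].
    by rewrite !inE; have [//|mi] := eqVneq m i; have [//|mj] := eqVneq m j; rewrite (only m) ?eqxx.
  by rewrite -E !inE (negPf mx) (negPf my) /= => /eqP.
have e1 : b i j + b i k = 0.
  by apply: one => //; rewrite /= !inE !negb_or ij (eq_sym i) ki (eq_sym j) kj.
have e2 : b j i + b j k = 0.
  apply: one; first by move=> l; rewrite !inE orbCA.
  by rewrite /= !inE !negb_or (eq_sym j) ij (eq_sym i) ki eq_sym kj.
have e3 : b k i + b k j = 0.
  apply: one; first by move=> l; rewrite !inE; do 3!case: eqP.
  by rewrite /= !inE !negb_or ij ki kj.
have : b i j *+ 2 = 0.
  rewrite -[RHS](subrr 0) -[X in X - _](addr0 0) -{1}e1 -{1}e2 -e3 (sym j i) (sym k i) (sym k j).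
  by rewrite mulr2n; ring.
by move/eqP; rewrite mulrn_eq0 /= => /eqP.
Qed.

Section Curve.
Variables (R : realType) (n : nat) (T : tropical n).
Variables (P : set (set 'cV[R]_n)) (phi : nodal_map R T).
Hypotheses (phi_prelog : prelog_curve P phi) (phi_type : of_type P phi).
Hypothesis dir_primitive : forall f : flag T, primitive (dir (fe f) (fs f)).
Hypothesis dir_opp : forall (e : edge T) b, dir e (~~ b) = - dir e b.
Hypothesis weight_gt0 : forall e : edge T, (0 < weight e)%N.
Local Notation C := R[i].
Local Notation x_ := (flag_point phi).
Implicit Types (u : flag_data R T) (V : vertex T) (f g : flag T).

Local Notation at_ V := [pred f : flag T | fv f == V].

Lemma flag_point_inj V : {in at_ V &, injective x_}.
Proof.
move=> f g /eqP fV /eqP gV E; have [inj _ _ _ _] := phi_prelog.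
by apply: inj; rewrite fV gV E.
Qed.

Definition section_of u : form_section R T := fun V =>
  \row_i form_with_residues (at_ V) x_ (fun f => u f 0 i).

Definition quadratic u V : Prop := 
  \sum_(i < n) section_of u V 0 i * dlog (pullback (component phi V) (delta_mx 0 i)) = 0.

(** What membership in H means for the residues, before any graph theory: the residue theorem,
    regularity at unbounded flags, opposite residues at the nodes, and the vanishing of the
    contraction with d log. *)
Definition admissible u : Prop :=
  [/\ forall V, flag_sum u V = 0,
      forall f, ~~ bounded (fe f) -> u f = 0,
      forall f g, opposite f g -> u f + u g = 0
    & forall V, quadratic u V].

Lemma H_space_admissible s : H_space phi s ->
  admissible (residues phi s) /\ s = section_of (residues phi s).
Proof.
move=> [[reg log opp] quad].
(* Flag points of one component are distinct, so no bounded flag sits at the point of an unbounded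
   one and the form is regular there. *)
have unb f i : ~~ bounded (fe f) -> has_value (log_coef (s (fv f) 0 i) (x_ f)) (x_ f) 0.
  move=> nb; apply/regular_residue/reg => g gV gb E; move: nb.
  by rewrite -(@flag_point_inj (fv f) g f _ _ E) ?gb ?inE ?gV ?eqxx.
have val f i : has_value (log_coef (s (fv f) 0 i) (x_ f)) (x_ f) (residues phi s f 0 i).
  rewrite mxE; have [bd|nb] := boolP (bounded (fe f)); first by apply/residueP/log.
  by rewrite (residue_eq (unb f i nb)); apply: unb.
have pf V i : s V 0 i = form_with_residues (at_ V) x_ (fun f => residues phi s f 0 i) /\
    \sum_(f | at_ V f) residues phi s f 0 i = 0.
  apply: form_partial_fractions; first exact: flag_point_inj.
    by move=> p h; apply: reg => f fV _; apply: h; apply/eqP.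
  by move=> f /eqP <-.
have sE : s = section_of (residues phi s).
  by apply/funext => V; apply/rowP => i; rewrite !mxE; have [] := pf V i.
split=> //; split.
- by move=> V; apply/rowP => i; rewrite summxE mxE; have [] := pf V i.
- by move=> f nb; apply/rowP => i; rewrite !mxE (residue_eq (unb f i nb)).
- by move=> f g fg; apply/rowP => i; rewrite !mxE; apply: opp.
- by move=> V; rewrite /quadratic -sE.
Qed.

Lemma section_of_residue u f i : (forall V, flag_sum u V = 0) ->
  has_value (log_coef (section_of u (fv f) 0 i) (x_ f)) (x_ f) (u f 0 i).
Proof.
move=> s0; rewrite mxE; have inj := @flag_point_inj (fv f).
apply: (form_with_residues_log_coef inj (rho := fun f => u f 0 i)) => /=; last exact: eqxx.
by have /rowP/(_ i) := s0 (fv f); rewrite summxE mxE.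
Qed.

Lemma residues_section_of u : (forall V, flag_sum u V = 0) -> residues phi (section_of u) = u.
Proof.
move=> s0; apply/funext => f; apply/rowP => i; rewrite mxE.
exact/residue_eq/section_of_residue.
Qed.

Lemma admissible_H_space u : admissible u -> H_space phi (section_of u).
Proof.
move=> [s0 unb opp quad]; split=> //; split.
- move=> V p i h; rewrite mxE.
  (* Unbounded flags carry the value 0; dropping them shows that their points are not poles. *)
  have -> : form_with_residues (at_ V) x_ (fun f => u f 0 i) =
            form_with_residues [pred f | at_ V f && bounded (fe f)] x_ (fun f => u f 0 i).
    rewrite !form_with_residuesE big_mkcondr; apply: eq_bigr => f _; case: ifPn => // nb.
    by rewrite (unb _ nb) mxE /ratfun_const polyC0 tofrac0 mul0r.
  apply: form_with_residues_regular; last by move=> f /andP[/eqP fV bd]; apply: h.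
  have /rowP/(_ i) := s0 V; rewrite summxE mxE => {2}<-.
  rewrite big_mkcondr; apply: eq_bigr => f _; case: ifPn => // nb.
  by rewrite (unb _ nb) mxE.
- by move=> f i bd; exists (u f 0 i); apply: section_of_residue.
- move=> f g i fg; rewrite !(residue_eq (section_of_residue _ _ s0)).
  by have /rowP/(_ i) := opp f g fg; rewrite !mxE.
Qed.

(** * The quadratic condition at a vertex *)

Local Notation b_ u := (fun f g : flag T => a_ u f g + a_ u g f).

Lemma dirC_opp (e : edge T) b : dirC R e (~~ b) = - dirC R e b.
Proof. by apply/matrixP => i j; rewrite !mxE dir_opp mxE rmorphN. Qed.

Lemma pairing_delta (t : 'I_n) (D : 'cV[int]_n) : ((delta_mx 0 t : 'rV_n) *m D) 0 0 = D t 0.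
Proof. by rewrite -rowE mxE. Qed.

Lemma a_E u f g : a_ u f g = \sum_(t < n)
  (weight (fe f))%:R * (((delta_mx 0 t : 'rV[int]_n) *m dir (fe f) (fs f)) 0 0)%:~R * u g 0 t.
Proof.
rewrite /a_ mxE mulr_sumr; apply: eq_bigr => t _.
by rewrite pairing_delta mxE [u g 0 t * _]mulrC mulrA.
Qed.

Lemma balancing V (m : 'rV[int]_n) : \sum_(f : flag T | fv f == V)
  (weight (fe f))%:R * ((m *m dir (fe f) (fs f)) 0 0)%:~R = 0 :> C.
Proof.
by have [] := dlog_pullback phi_prelog phi_type dir_primitive m (@flag_point_inj V).
Qed.

Lemma a_sum_residues u V f : flag_sum u V = 0 -> \sum_(g | fv g == V) a_ u f g = 0.
Proof.
move=> s0; rewrite -mulr_sumr -summxE -mulmx_suml.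
have -> : \sum_(g | fv g == V) u g = flag_sum u V by [].
by rewrite s0 mul0mx mxE mulr0.
Qed.

(* Here the sum is that of the residues of dlog at V. *)
Lemma a_sum_directions u V f : \sum_(g | fv g == V) a_ u g f = 0.
Proof.
under eq_bigr do rewrite a_E.
rewrite exchange_big big1 // => t _.
by rewrite -mulr_suml balancing mul0r.
Qed.

Lemma b_sum u V f : flag_sum u V = 0 -> \sum_(g | fv g == V) b_ u f g = 0.
Proof. by move=> s0; rewrite big_split /= a_sum_residues // a_sum_directions addr0. Qed.

Lemma b_diag u f : (b_ u f f = 0) <-> (a_ u f f = 0).
Proof.
split=> [/eqP|->]; last by rewrite addr0.
by rewrite -mulr2n mulrn_eq0 /= => /eqP.
Qed.

Lemma b_sym u f g : b_ u f g = b_ u g f.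
Proof. exact: addrC. Qed.

(** Expanding both factors into poles gives conditions at the finite flags only. The row sums of
    [b_] vanish, by the residue theorem for u and by balancing, and this extends the conditions to a
    flag at infinity and to all vectors e. *)
Lemma quadraticP u V : flag_sum u V = 0 -> quadratic u V <->
  forall f, fv f = V -> a_ u f f = 0 /\
    forall e, polar_sum (at_ V) (b_ u) (@hcoord C \o x_) f e = 0.
Proof.
move=> s0; rewrite /quadratic.
have -> : \sum_(i < n) section_of u V 0 i * dlog (pullback (component phi V) (delta_mx 0 i)) =
  \sum_(i < n) form_with_residues (at_ V) x_ (fun f => u f 0 i) *
     form_with_residues (at_ V) x_
       (fun f => (weight (fe f))%:R * (((delta_mx 0 i : 'rV[int]_n) *m dir (fe f) (fs f)) 0 0)%:~R).
  apply: eq_bigr => i _; rewrite mxE.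
  by have [-> _] := dlog_pullback phi_prelog phi_type dir_primitive (delta_mx 0 i) (@flag_point_inj V).
rewrite (contraction_eq0 (@flag_point_inj V)).
pose d (t : 'I_n) f : C := (weight (fe f))%:R * (((delta_mx 0 t : 'rV[int]_n) *m dir (fe f) (fs f)) 0 0)%:~R.
have -> : (fun f g => \sum_(t < n) d t f * u g 0 t + \sum_(t < n) d t g * u f 0 t) = b_ u.
  by apply/funext => f; apply/funext => g; rewrite !a_E.
have rows f : at_ V f -> \sum_(g | at_ V g) b_ u f g = 0 by move=> _; apply: b_sum.
have H := @finite_residues_polar_sum _ _ (at_ V) (b_ u) (b_sym u) x_ (@flag_point_inj V) rows.
split=> [h f fV|h f /eqP fV xf].
  have [] := H.1 _ f; last by move=> /b_diag.
    by move=> g /eqP gV xg; have [] := h g (introT eqP gV) xg; rewrite -a_E => /b_diag.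
  exact/eqP.
have [] := H.2 _ f; last by move=> /b_diag; rewrite a_E.
- by move=> g /eqP gV; have [/b_diag] := h g gV.
- exact/eqP.
- exact: xf.
Qed.

Lemma card_at V : #|at_ V| = valence V.
Proof. by rewrite /valence cardsE. Qed.

Lemma quadratic_le3 u V : (valence V <= 3)%N -> flag_sum u V = 0 ->
  (forall f, a_ u f f = 0) -> quadratic u V.
Proof.
move=> V3 s0 a0; apply/(quadraticP s0) => f fV; split=> // e.
rewrite /polar_sum big1 // => g /andP[/eqP gV _].
rewrite (@sym_zero_rows_le3 _ _ (at_ V) (b_ u)) ?mul0r //= ?card_at ?fV ?gV //.
- exact: b_sym.
- by move=> k _; rewrite a0 addr0.
- by move=> k _; apply: b_sum.
Qed.

(** * Vertices of valence at least four in the affine coordinate *)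

Section Coordinates.
Variables (infty : vertex T -> flag T) (zeta_ : vertex T -> 'M[C]_2) (p_ : flag T -> C).
Hypothesis coordinates : affine_coordinates phi infty zeta_ p_.

Lemma flag_sum_infty u V : (4 <= valence V)%N ->
  flag_sum u V = u (infty V) + \sum_(f | finite_flag infty V f) u f.
Proof.
move=> V4; have [iV _ _ _] := coordinates V4.
by rewrite /flag_sum (bigD1 (infty V)) ?iV.
Qed.

Lemma finite_residue_coordinates u V f : (4 <= valence V)%N -> finite_flag infty V f ->
  finite_residue (at_ V) (b_ u) (moebius (zeta_ V) \o x_) f =
  \sum_(g | finite_flag infty V g && (g != f)) b_ u f g * (p_ f - p_ g)^-1.
Proof.
move=> V4 /andP[/eqP fV fi]; have [iV _ xi xf] := coordinates V4.
(* In this coordinate the point of [infty V] has the vector (1, 0), so its term is zero. *)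
rewrite /finite_residue /polar_sum (bigD1 (infty V)) /=; last by rewrite iV eqxx eq_sym.
rewrite xi {1}/cross /= mulr0 mul0r subrr mul0r mulr0 add0r.
apply: eq_big => [g|g /andP[/andP[/eqP gV gf] gi]]; first by rewrite /finite_flag andbAC.
by rewrite !xf // /cross /= mul0r subr0 !mulr1 !mul1r.
Qed.

(** Moebius invariance moves the condition to the coordinate zeta, where the finite residues are the
    coefficients of the Lagrange form of P. *)
Lemma quadratic_P_poly u V : (4 <= valence V)%N -> flag_sum u V = 0 ->
  (forall f, fv f = V -> a_ u f f = 0) -> quadratic u V <-> P_poly infty p_ u V = 0.
Proof.
move=> V4 s0 a0; have [iV dz xi xf] := coordinates V4.
have inj' : {in at_ V &, injective (moebius (zeta_ V) \o x_)}.
  by move=> f g fV gV /(moebius_inj dz); apply: (@flag_point_inj V) fV gV.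
have p_inj : {in finite_flag infty V &, injective p_}.
  move=> f g /andP[/eqP fV fi] /andP[/eqP gV gi] E.
  by apply: inj'; rewrite ?inE ?fV ?gV //= !xf // E.
have := @offdiag_poly_eq0 C _ (finite_flag infty V) (a_ u) p_ p_inj.
rewrite -[offdiag_poly _ _ _]/(P_poly infty p_ u V) => ->.
have rows f : at_ V f -> \sum_(g | at_ V g) b_ u f g = 0 by move=> _; apply: b_sum.
have H := @finite_residues_polar_sum _ _ (at_ V) (b_ u) (b_sym u) _ inj' rows.
have b0 f : fv f = V -> b_ u f f = 0 by move=> fV; rewrite a0 // addr0.
rewrite quadraticP //; split=> [q f ff|q f fV].
  have /andP[/eqP fV fi] := ff.
  rewrite -(finite_residue_coordinates u V4 ff).
  have [_] := q f fV; rewrite (polar_sum_moebius _ _ _ _ dz) => E; exact: E.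
split; first exact: a0.
apply/(polar_sum_moebius _ _ _ _ dz).
have [] := H.1 _ f => // [g /eqP gV xg|]; last exact/eqP.
split; first exact: b0.
have fg : finite_flag infty V g.
  by rewrite /finite_flag gV eqxx; apply: contra_notN xg => /eqP ->.
by rewrite (finite_residue_coordinates u V4 fg); apply: q.
Qed.

(** The r + 1 finite flags bound the size of P by r, so that these are all its coefficients. *)
Lemma P_poly_coefs u V r : valence V = (r + 2)%N -> (2 <= r)%N ->
  (forall k, (k < r)%N -> (P_poly infty p_ u V)`_k = 0) <-> P_poly infty p_ u V = 0.
Proof.
move=> Vr r2; split=> [h|->]; last by move=> k _; rewrite coef0.
apply/polyP => k; rewrite coef0; have [/h //|rk] := ltnP k r.
have [|iV _ _ _] := coordinates (q := V); first by rewrite Vr addn2 !ltnS.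
have sz := @size_offdiag_poly C _ (finite_flag infty V) (a_ u) p_.
apply: nth_default; apply: leq_trans sz (leq_trans _ rk).
have := cardD1 (infty V) (at_ V); rewrite card_at Vr inE iV ?Vr ?addn2 // eqxx => -[]; rewrite add0n => cE.
suff -> : #|finite_flag infty V| = #|[predD1 at_ V & infty V]| by rewrite -cE.
by apply: eq_card => f; rewrite !inE andbC.
Qed.

End Coordinates.

(** * Conditions (I) and (II) *)

Lemma admissible_diag u : admissible u -> forall f, a_ u f f = 0.
Proof. by move=> [s0 _ _ q] f; have [] := (quadraticP (s0 (fv f))).1 (q _) f erefl. Qed.

Lemma weightC_neq0 (e : edge T) : (weight e)%:R != 0 :> C.
Proof. by rewrite pnatr_eq0 -lt0n. Qed.

Lemma a_eq0 u f g : a_ u f g = 0 <-> u g *m dirC R (fe f) (fs f) = 0.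
Proof.
split=> [/eqP|h]; last by rewrite /a_ h mxE mulr0.
rewrite mulf_eq0 (negPf (weightC_neq0 _)) /= => /eqP h.
by apply/matrixP => i j; rewrite !ord1 h mxE.
Qed.

Lemma annihilates_dir (a : 'rV[C]_n) (e : edge T) b c : a *m dirC R e b = 0 -> a *m dirC R e c = 0.
Proof.
have [->//|bc h] := eqVneq b c.
have -> : c = ~~ b by case: (b) (c) bc => [] [].
by rewrite dirC_opp mulmxN h oppr0.
Qed.

(** For a bridge, the values at all flags with vertex on the side [A] of f add up to 0, vertex by
    vertex. Apart from f, these flags cancel in opposite pairs or are unbounded with value 0, so u f
    = 0. *)
Lemma admissible_condI u : admissible u -> condI u.
Proof.
move=> [s0 unb opp _] f fL; have [bd|] := boolP (bounded (fe f)); last exact: unb.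
have [h [hf ho]] : exists h, opposite f h /\ opposite_flag f = h.
  by exists (opposite_flag f); split=> //; apply: opposite_flagP.
pose A := connect (adjacent ([set: edge T] :\ fe f)) (fv f).
have hA : ~~ A (fv h).
  case/andP: hf => /eqP E s; have Ef := flag_endpt f; have Eh := flag_endpt h.
  rewrite -E in Eh; move: s Ef Eh; rewrite /A; case: (fs f) (fs h) => [] [] //= _ Ef Eh.
    by rewrite adjacent_connect_sym; apply: bridge_disconnects.
  exact: bridge_disconnects.
have AN g : bounded (fe g) -> fe g != fe f -> A (fv g) = A (fv (opposite_flag g)).
  move=> gb gf; have /andP[/eqP E s] := opposite_flagP gb.
  apply: same_connect_r; first exact: adjacent_connect_sym.
  apply: connect1; apply/existsP; exists (fe g); rewrite !inE gf /=.
  apply/existsP; exists (fs g); rewrite flag_endpt eqxx /=.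
  have -> : ~~ fs g = fs (opposite_flag g) by case: (fs g) (fs (opposite_flag g)) s => [] [].
  by rewrite {1}E flag_endpt.
have sum0 : \sum_(g | A (fv g)) u g = 0.
  rewrite (partition_big (fun g => fv g) A) //= big1 // => V AV.
  rewrite -[RHS](s0 V); apply: eq_bigl => g.
  by apply/idP/idP => [/andP[]//|/eqP gV]; rewrite gV eqxx andbT.
pose B g := A (fv g) && (g != f).
have Bopp g : B (opposite_flag g) = B g.
  rewrite /B; have [gb|nb] := boolP (bounded (fe g)); last by rewrite opposite_flag_unbounded.
  have [gf|gf] := eqVneq (fe g) (fe f); last first.
    rewrite -AN //; congr (_ && _); have /andP[/eqP E _] := opposite_flagP gb.
    have -> : opposite_flag g != f by apply: contraNneq gf => <-; rewrite E.
    by symmetry; apply: contraNneq gf => ->.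
  have [->|gf'] := same_edge_flags gf; first by rewrite ho (negPf hA) eqxx andbF.
  have -> : g = h by apply: (opposite_inj (f := f)) hf; rewrite opposite_sym.
  by rewrite -ho opposite_flagK eqxx andbF ho (negPf hA).
have sumB : \sum_(g | B g) u g = 0.
  (* Taking opposites is an involution of [B] that changes the sign of u; its fixed points are the
     unbounded flags, where u is 0. *)
  have E : \sum_(g | B g) u g = - \sum_(g | B g) u g.
    rewrite {1}(reindex_inj (inv_inj (@opposite_flagK T))) /= -sumrN.
    apply: eq_big => [g|g _]; first exact: Bopp.
    have [gb|nb] := boolP (bounded (fe g)); last by rewrite opposite_flag_unbounded // unb // oppr0.
    by apply/eqP; rewrite -addr_eq0 addrC opp // opposite_flagP.
  apply/matrixP => i j; rewrite mxE; move/matrixP/(_ i j)/eqP: E.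
  by rewrite [X in _ == X]mxE -addr_eq0 -mulr2n mulrn_eq0 /= => /eqP.
move: sum0; rewrite (bigD1 f) /=; last exact: connect0.
by rewrite sumB addr0.
Qed.

Lemma two_flags u V f g : flag_sum u V = 0 -> (valence V < 3)%N -> fv f = V -> fv g = V -> f != g ->
  u g = - u f.
Proof.
move=> s0 V3 fV gV fg; apply/eqP; rewrite -addr_eq0 addrC -[X in _ == X]s0 /flag_sum.
rewrite (bigD1 f) ?fV //= (bigD1 g) /=; last by rewrite gV eqxx eq_sym.
rewrite big_pred0 ?addr0 // => k; apply/negP => /andP[/andP[/eqP kV kf] kg].
move: V3; rewrite ltnNge => /negP; apply.
have U : uniq [:: f; g; k] by rewrite /= !inE !negb_or fg eq_sym kf eq_sym kg.
apply: leq_trans (_ : #|[:: f; g; k]| <= _)%N; first by rewrite (card_uniqP U).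
rewrite -card_at; apply: subset_leq_card; apply/fintype.subsetP => l.
by rewrite !inE => /or3P[] /eqP ->; apply/eqP.
Qed.

(** Induction along the chain: passing to the other flag of an edge, or to the other flag at a
    vertex of valence less than 3, changes the sign. *)
Lemma chain_values u e e' : admissible u -> connect (@chain_step T) e e' -> e \in loop_part T ->
  forall f f', fe f = e -> fe f' = e' -> u f' = u f \/ u f' = - u f.
Proof.
move=> [s0 _ opp _] /connectP[p]; elim: p e => [|e1 p IH] e /= pe e'E eL f f' fE f'E.
  rewrite e'E in f'E; have [->|fo] := same_edge_flags (etrans fE (esym f'E)); first by left.
  by right; apply/eqP; rewrite -addr_eq0 addrC opp.
case/andP: pe => /and3P[_ e1L /existsP[v /and3P[v3 /existsP[b /eqP ev] /existsP[b1 /eqP e1v]]]] p1.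
have [g [gv ge _]] := flag_exists ev; have [g1 [g1v g1e _]] := flag_exists e1v.
have ug : u g = u f \/ u g = - u f.
  have [->|fo] := same_edge_flags (etrans fE (esym ge)); first by left.
  by right; apply/eqP; rewrite -addr_eq0 addrC opp.
have ug1 : u g1 = u g \/ u g1 = - u g.
  have [->|gg1] := eqVneq g g1; first by left.
  by right; apply: (two_flags (s0 v)).
have := IH e1 p1 e'E e1L g1 f' g1e f'E.
by case=> ->; case: ug1 => ->; case: ug => ->; rewrite ?opprK; auto.
Qed.

Lemma annihilates_span (a : 'rV[C]_n) (s : seq 'cV[C]_n) :
  (forall y, y \in s -> a *m y = 0) -> annihilates a <<s>>%VS.
Proof.
move=> h y; rewrite -[s]/(tval (in_tuple s)) => /coord_span ->.
rewrite mulmx_sumr big1 // => i _; rewrite -scalemxAr h ?scaler0 //.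
by apply: mem_nth.
Qed.

(** The value at f is, up to sign, the value at a flag of any edge e' of the chain, and the latter
    kills the direction of e' by the diagonal condition. *)
Lemma admissible_condII u : admissible u -> condII u.
Proof.
move=> au f fL; apply: annihilates_span => y /mapP[e'].
rewrite mem_enum inE => ch ->.
(* An edge of the chain has a flag: it lies in the loop part and so is bounded, or it is the edge of
   f. *)
have [e'b] : exists b, endpt e' b.
  have : bounded e' || (e' == fe f).
    have /connectP[p pe ->] := ch; case: p pe => [|e1 p]; first by rewrite /= eqxx orbT.
    move=> /= /andP[/and3P[_ e1L _]]; elim: p e1 e1L => [|e2 p IH] e1 e1L /=.
      by rewrite loop_part_bounded.
    by move=> /andP[/and3P[_ e2L _]]; apply: IH.
  case/orP => [/andP[? _]|/eqP ->]; first by exists false.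
  by exists (fs f); rewrite flag_endpt.
case E: (endpt e' e'b) => [w|//] _; have [f' [_ f'e f'b]] := flag_exists E.
have := (a_eq0 u f' f').1 (admissible_diag au f'); rewrite f'e => /(annihilates_dir false) h.
case: (chain_values au ch fL erefl f'e) h => ->; first by [].
by rewrite mulNmx => /eqP; rewrite oppr_eq0 => /eqP.
Qed.

(** * Condition (III) *)

Lemma cond_diag u : condI u -> condII u -> forall f, a_ u f f = 0.
Proof.
move=> cI cII f; apply/a_eq0; have [fL|fL] := boolP (fe f \in loop_part T); last first.
  by rewrite cI // mul0mx.
apply: (@annihilates_dir _ _ false); apply: (cII f fL); apply: memv_span.
by apply/mapP; exists (fe f); rewrite // mem_enum inE connect0.
Qed.

(** Balancing, paired with a character that is 1 on the direction of a single flag, would make its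
    weight zero. *)
Lemma valence_neq1 V : valence V <> 1%N.
Proof.
rewrite -card_at => V1; have [f fE] := mem_card1 V1.
have [m m1] := primitive_pairing1 (@dir_primitive f).
have := balancing V m; rewrite (big_pred1 f) => [|g]; last exact: fE.
by rewrite m1 mulr1 => /eqP; rewrite (negPf (weightC_neq0 _)).
Qed.

(** Vanishing of the vertex sums is spread over the conditions according to the valence: 2, 3, or at
    least 4. Given (I) and (II) the diagonal terms vanish, so the quadratic condition is automatic
    up to valence 3 and is P = 0 beyond. *)
Lemma admissible_condIII infty zeta_ p_ u : affine_coordinates phi infty zeta_ p_ ->
  condI u -> condII u -> admissible u <-> condIII infty p_ u.
Proof.
move=> crd cI cII; have a0 := cond_diag cI cII.
split=> [[s0 unb opp q]|[c3 c4 cL c2]].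
  split=> [V _|V r r2 Vr|f g fg _|V _]; [exact: s0| |exact: opp|exact: s0].
  have V4 : (4 <= valence V)%N by rewrite Vr addn2 !ltnS.
  split; [|by move=> f _; apply: a0|].
    by apply/eqP; rewrite -addr_eq0 -(flag_sum_infty crd) // s0.
  apply/(P_poly_coefs crd) => //.
  by apply/(quadratic_P_poly crd (u := u) V4 (s0 V)) => //; apply: q.
have V2 V : (4 <= valence V)%N -> (2 <= valence V - 2)%N /\ valence V = (valence V - 2 + 2)%N.
  by move=> V4; rewrite subnK ?leq_subRL // (leq_trans _ V4).
have s0 V : flag_sum u V = 0.
  have [V4|] := leqP 4 (valence V).
    have [r2 Vr] := V2 V V4; have [uE _ _] := c4 V _ r2 Vr.
    by rewrite (flag_sum_infty crd) // uE addNr.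
  case E: (valence V) => [|[|[|[|//]]]] _.
  - rewrite /flag_sum big_pred0 // => f; have := card0_eq (etrans (card_at V) E) f; by rewrite inE.
  - by case: (valence_neq1 E).
  - exact: c2.
  - exact: c3.
split=> [//|f nb|f g fg|V].
- by apply: cI; apply: contraNN nb; apply: loop_part_bounded.
- have [fL|fL] := boolP (fe f \in loop_part T); first exact: cL.
  by rewrite !cI ?addr0 //; case/andP: fg => /eqP <-.
- have [V4|V3] := leqP 4 (valence V); last exact: quadratic_le3.
  apply/(quadratic_P_poly crd V4 (s0 V)) => //.
  have [r2 Vr] := V2 V V4.
  by have [_ _ coefs] := c4 V _ r2 Vr; apply: (P_poly_coefs crd u Vr r2).1.
Qed.

(** * Linear structure of H *)

Lemma section_of_linear (c : C) u w : section_of (fun f => c *: u f + w f) =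
  (fun V => ratfun_const c *: section_of u V + section_of w V).
Proof.
apply/funext => V; apply/rowP => i; rewrite !mxE !form_with_residuesE mulr_sumr -big_split.
by apply: eq_bigr => f _; rewrite !mxE ratfun_constD ratfun_constM mulrDl mulrA.
Qed.

Lemma admissible_linear (c : C) u w : admissible u -> admissible w ->
  admissible (fun f => c *: u f + w f).
Proof.
move=> [s0 unb opp q] [s0' unb' opp' q']; split.
- by move=> V; rewrite /flag_sum big_split /= -scaler_sumr [X in _ *: X]s0 [X in _ + X]s0' scaler0 addr0.
- by move=> f nb; rewrite unb // unb' // scaler0 addr0.
- by move=> f g fg; rewrite addrACA -scalerDr opp // opp' // scaler0 addr0.
- move=> V; rewrite /quadratic section_of_linear.
  have := q V; have := q' V; rewrite /quadratic => qV' qV.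
  pose D i := dlog (pullback (component phi V) (delta_mx 0 i : 'rV[int]_n)).
  rewrite (eq_bigr (fun i => ratfun_const c * (section_of u V 0 i * D i) + section_of w V 0 i * D i)).
    by rewrite big_split /= -mulr_sumr qV qV' mulr0 addr0.
  by move=> i _; rewrite mxE [X in X + _]mxE mulrDl mulrA.
Qed.

Lemma admissible0 : admissible (fun=> 0).
Proof.
split=> [V|//|f g _|V].
- by rewrite /flag_sum big1.
- by rewrite addr0.
apply/quadraticP; first by rewrite /flag_sum big1.
move=> f _; have z g h : a_ (fun=> 0 : 'rV[C]_n) g h = 0 by apply/a_eq0; rewrite mul0mx.
by split=> [|e]; rewrite ?z // /polar_sum big1 // => g _; rewrite !z addr0 mul0r.
Qed.

End Curve.

(** * Application to the contraction of a tropical curve *)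

Lemma primitive_opp (n : nat) (u : 'cV[int]_n) : primitive u -> primitive (- u).
Proof. by move=> up k w E; apply: (up k (- w)); rewrite scalerN -E opprK. Qed.

Lemma section_of0 (R : realType) (n : nat) (T : tropical n) (phi : nodal_map R T) :
  section_of phi (fun=> 0) = fun=> 0.
Proof.
apply/funext => V; apply/rowP => i; rewrite !mxE form_with_residuesE big1 // => f _.
by rewrite ?mxE /ratfun_const polyC0 tofrac0 mul0r.
Qed.

Theorem theorem64 (R : realType) (n : nat) (T : tropical n)
    (P : set (set 'cV[R]_n)) (phi : nodal_map R (contraction T))
    (infty : vertex (contraction T) -> flag (contraction T))
    (zeta_ : vertex (contraction T) -> 'M[R[i]]_2)
    (p_ : flag (contraction T) -> R[i])
    (T_tropical : is_tropical T)
    (T_assumptionA : assumptionA R T)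
    (P_respects_T : respects T P)
    (phi_prelog : prelog_curve P phi)
    (phi_type : of_type P phi)
    (coordinates : affine_coordinates phi infty zeta_ p_) :
  (* H is a complex vector space and taking residues is linear and injective *)
  [/\ H_space phi (fun=> 0)
      /\ forall (c : R[i]) s t, H_space phi s -> H_space phi t ->
        let st := fun V => ratfun_const c *: s V + t V in
        H_space phi st /\
        forall f, residues phi st f = c *: residues phi s f + residues phi t f,
      forall s t, H_space phi s -> H_space phi t ->
        residues phi s = residues phi t -> s = t,
      forall s, H_space phi s -> condI (residues phi s) /\ condII (residues phi s)
    & forall u : flag_data R (contraction T), condI u -> condII u ->
        ((exists2 s, H_space phi s & residues phi s = u)
         <-> condIII infty p_ u)].
Proof.
have [[_ w0 _ _] dopp dprim _ _] := T_tropical.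
have cdopp (e : edge (contraction T)) b : dir e (~~ b) = - dir e b by apply: dopp.
(* Edges of the contraction are those not contracted by h, so their directions are primitive at one
   end, and by opposition at the other. *)
have cprim (f : flag (contraction T)) : primitive (dir (fe f) (fs f)).
  have nc := valP (fe f); have pf : primitive (dir (val (fe f)) false).
    by case: (dprim (val (fe f))) => // /andP[c _]; rewrite c in nc.
  by case: (fs f); [rewrite (cdopp (fe f) false); apply: primitive_opp|].
have cw (e : edge (contraction T)) : (0 < weight e)%N by apply: w0.
have H_adm s : H_space phi s -> admissible phi (residues phi s) /\ s = section_of phi (residues phi s).
  exact: H_space_admissible phi_prelog s.
have adm_H u : admissible phi u -> H_space phi (section_of phi u).
  exact: admissible_H_space phi_prelog u.
have res_sec u : admissible phi u -> residues phi (section_of phi u) = u.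
  by case=> s0 _ _ _; apply: (residues_section_of phi_prelog).
split.
- split.
    by rewrite -(section_of0 phi); apply/adm_H/(admissible0 phi_prelog phi_type cprim).
  move=> c s t Hs Ht st; have [as_ sE] := H_adm s Hs; have [at_ tE] := H_adm t Ht.
  have ast := admissible_linear c as_ at_.
  have stE : st = section_of phi (fun f => c *: residues phi s f + residues phi t f).
    by rewrite section_of_linear -sE -tE.
  by rewrite stE; split; [apply: adm_H|move=> f; rewrite res_sec].
- move=> s t Hs Ht E; have [_ ->] := H_adm s Hs; have [_ ->] := H_adm t Ht.
  by rewrite E.
- move=> s /H_adm[as_ _]; split; first exact: admissible_condI as_.
  exact: (admissible_condII phi_prelog phi_type cprim cdopp cw as_).
- move=> u cI cII.
  rewrite -(admissible_condIII phi_prelog phi_type cprim cdopp cw coordinates cI cII).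
  split=> [[s Hs <-]|au]; first by have [] := H_adm s Hs.
  by exists (section_of phi u); [apply: adm_H|apply: res_sec].
Qed.
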